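(* Let $P$ be a $d$-polytope. Suppose the vertex-facet incidence graph $\Gamma_P$ has a $d$-degenerate ordering of its nodes such that the following two conditions hold: (i) for each facet in this ordering, the vertices appearing after it and connected to it by an edge are linearly independent in any centered realization of $P$; (ii) for each vertex in this ordering, the normal vectors of the facets appearing after it and connected to it by an edge are linearly independent in any centered realization of $P$. Then $\mathcal{R}_{\mathbf 0}(P)$ is a smooth manifold of dimension $\mathrm{NG}(P)$.
   Context: A $d$-polytope is a $d$-dimensional convex polytope. Polytopes are labeled: the $n=f_0(P)$ vertices and $m=f_{d-1}(P)$ facets are numbered; $f_{0,d-1}(P)$ is the number of vertex-facet incidences. A labeled $d$-polytope $Q\subset\mathbb{R}^d$ realizes $P$ if there is an isomorphism between the face lattices of $P$ and $Q$ respecting the labels of vertices and facets; the realization is centered if $\mathbf 0$ is in the interior of $Q$. The centered realization space is $$\mathcal{R}_{\mathbf 0}(P)=\{(V,A)\in\mathbb{R}^{d\times(n+m)} \mid \operatorname{conv}(V)=\{\mathbf x\in\mathbb{R}^d\mid A^t\mathbf x\le\mathbf 1\}\text{ realizes }P\},$$ where $\operatorname{conv}(V)$ is the convex hull of the columns of $V$; in a centered realization $(V,A)$ the $i$-th column of $V$ is the $i$-th vertex and the $j$-th column of $A$ is the normal vector of the $j$-th facet. ''Smooth manifold'' means smoothly embedded submanifold of $\mathbb{R}^{d\times(n+m)}$. The natural guess is $\mathrm{NG}(P)=d(f_0(P)+f_{d-1}(P))-f_{0,d-1}(P)$. The vertex-facet incidence graph $\Gamma_P$ is the bipartite graph whose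 nodes are the vertices and the facets of $P$, with an edge between a vertex and a facet iff the vertex lies in the facet. An ordering of the nodes of a graph is $k$-degenerate if each node has at most $k$ neighbors appearing after it in the ordering. *)

(* Defs.v *)
From HB Require Import structures.
From mathcomp Require Import all_boot all_order all_algebra.
From mathcomp Require Import all_classical all_reals all_analysis.

Set Implicit Arguments.
Unset Strict Implicit.
Unset Printing Implicit Defensive.

Import Order.TTheory GRing.Theory Num.Theory.
Import numFieldNormedType.Exports.

Local Open Scope classical_set_scope.
Local Open Scope ring_scope.

Section Polytopes.
Context {R : realType} {e : nat}.
Implicit Types S Q F : set 'cV[R]_e.

Definition convex_hull S : set 'cV[R]_e :=
  [set x | exists k (p : 'I_k -> 'cV[R]_e) (c : 'I_k -> R),
     [/\ forall i, S (p i), forall i, 0 <= c i, \sum_i c i = 1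
       & x = \sum_i c i *: p i]].

Definition affine_hull S : set 'cV[R]_e :=
  [set x | exists k (p : 'I_k -> 'cV[R]_e) (c : 'I_k -> R),
     [/\ forall i, S (p i), \sum_i c i = 1 & x = \sum_i c i *: p i]].

(* The empty set has dimension -1, so that the unique facet of a 0-polytope is
   its empty face. *)
Definition has_dim S (k : int) : Prop :=
  (S = set0 /\ k = -1) \/
  exists (x : 'cV[R]_e) (U : {vspace 'cV[R]_e}),
    [/\ S x, affine_hull S = [set x + u | u in [set u | u \in U]]
      & k = (\dim U)%:Z].

Definition polytope Q : Prop :=
  exists2 S : set 'cV[R]_e, finite_set S & Q = convex_hull S.

(* Taking c = 0 yields the two improper faces Q and set0. *)
Definition face Q F : Prop :=
  exists (c : 'cV[R]_e) (b : R),
    (forall x, Q x -> (c^T *m x) 0 0 <= b) /\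
    F = [set x | Q x /\ (c^T *m x) 0 0 = b].

Definition vertices Q : set 'cV[R]_e := [set v | face Q [set v]].

Definition facets (d : nat) Q : set (set 'cV[R]_e) :=
  [set F | face Q F /\ has_dim F (d%:Z - 1)].

End Polytopes.

Record labeled_body (R : realType) (e n m : nat) := LabeledBody {
  body : set 'cV[R]_e;
  vtx : 'I_n -> 'cV[R]_e;
  fct : 'I_m -> set 'cV[R]_e }.

(* A labeled d-polytope with n = f_0 vertices and m = f_{d-1} facets, possibly
   lying in a space R^e of larger dimension. *)
Definition labeled_polytope (R : realType) (d e n m : nat)
    (P : labeled_body R e n m) : Prop :=
  [/\ polytope (body P), has_dim (body P) d%:Z,
      set_bij [set: 'I_n] (vertices (body P)) (vtx P)
    & set_bij [set: 'I_m] (facets d (body P)) (fct P)].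

Definition labeled_face_isomorphism (R : realType) (e e' n m : nat)
    (P : labeled_body R e n m) (Q : labeled_body R e' n m)
    (phi : set 'cV[R]_e -> set 'cV[R]_e') : Prop :=
  [/\ set_bij (face (body P)) (face (body Q)) phi,
      forall F G, face (body P) F -> face (body P) G ->
        (F `<=` G <-> phi F `<=` phi G),
      forall i, phi [set vtx P i] = [set vtx Q i]
    & forall j, phi (fct P j) = fct Q j].

Definition realizes (R : realType) (d e n m : nat)
    (Q : labeled_body R d n m) (P : labeled_body R e n m) : Prop :=
  labeled_polytope d Q /\ exists phi, labeled_face_isomorphism P Q phi.

Section CenteredRealizations.
Context {R : realType} {d n m : nat}.
Implicit Types (V : 'M[R]_(d, n)) (A : 'M[R]_(d, m)).

Definition conv_cols V : set 'cV[R]_d :=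
  convex_hull (range (fun i => col i V)).

Definition halfspaces A : set 'cV[R]_d :=
  [set x | forall j, (A^T *m x) j 0 <= 1].

Definition labeled_conv V A : labeled_body R d n m :=
  LabeledBody (conv_cols V) (fun i => col i V)
    (fun j => [set x | conv_cols V x /\ (A^T *m x) j 0 = 1]).

(* The pair (V, A) is encoded as the d x (n + m) matrix [V | A]. *)
Definition centered_realization_space (e : nat) (P : labeled_body R e n m) :
    set 'M[R]_(d, n + m) :=
  [set X | conv_cols (lsubmx X) = halfspaces (rsubmx X) /\
           realizes (labeled_conv (lsubmx X) (rsubmx X)) P].

End CenteredRealizations.

Section IncidenceGraph.
Context {R : realType} {e n m : nat}.
Context (P : labeled_body R e n m).

Definition incident (i : 'I_n) (j : 'I_m) : bool := `[< fct P j (vtx P i) >].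

Definition incidence_graph : rel ('I_n + 'I_m)%type :=
  fun x y => match x, y with
  | inl i, inr j | inr j, inl i => incident i j
  | _, _ => false
  end.

Definition incidence_number : nat :=
  #|[pred ij : 'I_n * 'I_m | incident ij.1 ij.2]|.

Definition natural_guess (d : nat) : int :=
  (d * (n + m))%N%:Z - incidence_number%:Z.

End IncidenceGraph.

Section Orderings.
Context {T : finType}.
Implicit Types (g : rel T) (s : seq T).

Definition node_ordering s : Prop := perm_eq s (enum T).

Definition later_neighbors g s (x : T) : {set T} :=
  [set y | g x y && (index x s < index y s)%N]%SET.

Definition degenerate_ordering (k : nat) g s : Prop :=
  node_ordering s /\ forall x, (#|later_neighbors g s x| <= k)%N.

End Orderings.

(* For open U, this is C^k; the quantification over all directions v is
   equivalent to one over the coordinate directions. *)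
Fixpoint Ck_on (R : realType) (E F : normedModType R) (k : nat) (U : set E)
    (f : E -> F) : Prop :=
  if k is k'.+1 then
    (forall x, U x -> differentiable f x) /\
    (forall v, Ck_on k' U (fun x => 'D_v f x))
  else forall x, U x -> {for x, continuous f}.

Definition smooth_on (R : realType) (E F : normedModType R) (U : set E)
    (f : E -> F) : Prop := forall k, Ck_on k U f.

Definition diffeomorphism (R : realType) (E F : normedModType R)
    (U : set E) (W : set F) (phi : E -> F) (psi : F -> E) : Prop :=
  [/\ smooth_on U phi, smooth_on W psi,
      forall x, U x -> W (phi x) /\ psi (phi x) = x
    & forall y, W y -> U (psi y) /\ phi (psi y) = y].

(* M is a smoothly embedded k-dimensional submanifold of the space of p x q
   matrices: near each of its points some chart of the ambient space straightens
   M to a k-dimensional linear subspace L (any such L is R^k x {0} in suitable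
   linear coordinates). *)
Definition smooth_submanifold (R : realType) (p q k : nat)
    (M : set 'M[R]_(p, q)) : Prop :=
  forall x, M x ->
  exists (U W : set 'M[R]_(p, q)) (phi psi : 'M[R]_(p, q) -> 'M[R]_(p, q))
         (L : {vspace 'M[R]_(p, q)}),
    [/\ open U /\ open W, U x, diffeomorphism U W phi psi, \dim L = k
      & phi @` (M `&` U) = W `&` [set y | y \in L]].

(* Main.v *)
Require Import Defs.
From HB Require Import structures.
From mathcomp Require Import all_boot all_order all_algebra.
From mathcomp Require Import all_classical all_reals all_analysis.
Import Order.TTheory GRing.Theory Num.Theory.
Import numFieldNormedType.Exports.
Local Open Scope classical_set_scope.
Local Open Scope ring_scope.

(** Near a centered realization [X0], the realization space is cut out by the
    equations [a_j . v_i = 1], one for each incident vertex [v_i] and facet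
    normal [a_j] ([near_realization_space]). That these equations hold on the
    realization space is clear. Conversely, let [X = (V, A)] be near [X0] and
    satisfy them. The inequalities [a_j . v_i < 1] for non-incident pairs
    persist, so [conv V] is contained in the polyhedron of [A]. For the other
    inclusion, a point outside [conv V] is cut off by some [c . x <= 1] that is
    a vertex of the polar of [conv V] ([polar_vertex]). The vertices on which
    [c] is active lie in a common facet [j], because otherwise their barycenter
    would be an interior point at [X0], and so also at [X]
    ([near_active_sub_facet]). On these vertices, which span the space, [c] and
    [a_j] both take the value 1; hence [c = a_j], and the point violates an
    inequality of [A] ([halfspaces_sub_hull]). Once both descriptions agree,
    the faces correspond to the sets of vertices that are closed under the
    incidences ([face_incidence_closed], [incidence_closed_face]); so the face
    lattice is determined by the incidences, which did not change
    ([transfer_labeled_polytope]).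

    The equations are triangular for the given ordering: attach each equation
    to whichever of its two nodes comes first. The equations attached to a node
    are then affine in its column, their coefficients are the later columns,
    and these are linearly independent at [X0]. Completing them by constant
    rows gives an invertible affine change of that column, depending on the
    later columns only. Performing these changes one after the other is a
    rational diffeomorphism near [X0] which maps the solutions to a coordinate
    subspace ([triangular_system_chart]), whose codimension is the number of
    incidences. The chart and its inverse are explicit rational maps, and
    rational maps are smooth ([rational_map_smooth]). *)

Set Implicit Arguments.
Unset Strict Implicit.
Unset Printing Implicit Defensive.

Section NearEqDifferentiable.
Context {R : numFieldType} {V W : normedModType R}.

Lemma near_eq_differentiable (f g : V -> W) (x : V) :
  (\near x, f x = g x) -> differentiable f x -> differentiable g x.
Proof.
move=> fg df; have fgx : f x = g x by exact: nbhs_singleton fg.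
have [dfc dfo] := (diff_locallyP x f).1 df.
have E : g \o shift x = cst (g x) + 'd f x +o_ 0 id.
  have {}dfo := (eqaddoP _ _ _ _).1 dfo.
  apply/eqaddoP => e e0; have := dfo e e0.
  have : \forall h \near 0, f (h + x) = g (h + x).
    by move: fg; rewrite (near_shift 0); apply: filterS => h /=; rewrite subr0.
  apply: filterS2 => h fgh; rewrite /= !fctE /= -fgx.
  by rewrite -fgh.
apply/diff_locallyP; rewrite (diff_unique dfc E); by split.
Qed.

End NearEqDifferentiable.

(** * Rational maps between matrix spaces *)

Section Rational.
Context {R : realType} {p q : nat}.
Local Notation E := 'M[R]_(p, q).
Implicit Types (U W : set E) (f g : E -> R).

(** Being closed under directional derivatives, a class of functions built from
    coordinates is smooth as soon as it is differentiable; being closed under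
    substitution, it contains the components of composites of charts.
    Extensionality on [U] is part of the class because the rules of derivation
    only hold where the functions are differentiable. *)
Inductive rational_on U : (E -> R) -> Prop :=
| RationalCst c : rational_on U (fun=> c)
| RationalCoord i j : rational_on U (fun X => X i j)
| RationalAdd f g : rational_on U f -> rational_on U g ->
    rational_on U (fun X => f X + g X)
| RationalMul f g : rational_on U f -> rational_on U g ->
    rational_on U (fun X => f X * g X)
| RationalInv f : rational_on U f -> (forall X, U X -> f X != 0) ->
    rational_on U (fun X => (f X)^-1)
| RationalExt f g : rational_on U f -> (forall X, U X -> f X = g X) ->
    rational_on U g.

Definition rational_map p' q' U (phi : E -> 'M[R]_(p', q')) :=
  forall i j, rational_on U (fun X => phi X i j).

Lemma rational_opp U f : rational_on U f -> rational_on U (fun X => - f X).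
Proof.
move=> rf; apply: RationalExt (RationalMul (RationalCst U (-1)) rf) _ => X _.
by rewrite mulN1r.
Qed.

Lemma rational_sum (I : Type) (r : seq I) (P : pred I) U (F : I -> E -> R) :
  (forall i, rational_on U (F i)) ->
  rational_on U (fun X => \sum_(i <- r | P i) F i X).
Proof.
move=> rF; elim: r => [|i r IH].
  by apply: RationalExt (RationalCst U 0) _ => X _; rewrite big_nil.
apply: (@RationalExt _ (fun X => (if P i then F i X else 0) +
    \sum_(j <- r | P j) F j X)).
  apply: RationalAdd => //; case: (P i) => //; exact: RationalCst.
by move=> X _; rewrite big_cons; case: (P i); rewrite ?add0r.
Qed.

Lemma rational_prod (I : Type) (r : seq I) (P : pred I) U (F : I -> E -> R) :
  (forall i, rational_on U (F i)) ->
  rational_on U (fun X => \prod_(i <- r | P i) F i X).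
Proof.
move=> rF; elim: r => [|i r IH].
  by apply: RationalExt (RationalCst U 1) _ => X _; rewrite big_nil.
apply: (@RationalExt _ (fun X => (if P i then F i X else 1) *
    \prod_(j <- r | P j) F j X)).
  apply: RationalMul => //; case: (P i) => //; exact: RationalCst.
by move=> X _; rewrite big_cons; case: (P i); rewrite ?mul1r.
Qed.

Lemma rational_det k U (B : E -> 'M[R]_k) :
  rational_map U B -> rational_on U (fun X => \det (B X)).
Proof.
move=> rB; rewrite /determinant; apply: rational_sum => s.
by apply: RationalMul; [exact: RationalCst|apply: rational_prod].
Qed.

Lemma rational_adj k U (B : E -> 'M[R]_k) :
  rational_map U B -> rational_map U (fun X => \adj (B X)).
Proof.
move=> rB i j; apply: (@RationalExt _ (fun X => cofactor (B X) j i)); last first.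
  by move=> X _; rewrite mxE.
apply: RationalMul; first exact: RationalCst.
by apply: rational_det => a b; apply: RationalExt (rB _ _) _ => X _; rewrite !mxE.
Qed.

Lemma rational_inv k U (B : E -> 'M[R]_k) :
  rational_map U B -> (forall X, U X -> B X \in unitmx) ->
  rational_map U (fun X => invmx (B X)).
Proof.
move=> rB uB i j.
apply: (@RationalExt _ (fun X => (\det (B X))^-1 * (\adj (B X)) i j)).
  apply: RationalMul; last exact: rational_adj.
  apply: RationalInv; first exact: rational_det.
  by move=> X UX; have := uB X UX; rewrite unitmxE unitfE.
by move=> X UX; rewrite /invmx uB// !mxE.
Qed.

Lemma rational_mul a b c U (B : E -> 'M[R]_(a, b)) (C : E -> 'M[R]_(b, c)) :
  rational_map U B -> rational_map U C -> rational_map U (fun X => B X *m C X).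
Proof.
move=> rB rC i j.
apply: (@RationalExt _ (fun X => \sum_k B X i k * C X k j)).
  by apply: rational_sum => k; apply: RationalMul.
by move=> X _; rewrite mxE.
Qed.

Lemma rational_add a b U (B C : E -> 'M[R]_(a, b)) :
  rational_map U B -> rational_map U C -> rational_map U (fun X => B X + C X).
Proof.
move=> rB rC i j; apply: RationalExt (RationalAdd (rB i j) (rC i j)) _ => X _.
by rewrite mxE.
Qed.

Lemma rational_cst a b U (C : 'M[R]_(a, b)) : rational_map U (fun=> C).
Proof. by move=> i j; exact: RationalCst. Qed.

Lemma rational_on_subset U W f : W `<=` U -> rational_on U f -> rational_on W f.
Proof.
move=> WU; elim.
- exact: RationalCst.
- exact: RationalCoord.
- by move=> *; apply: RationalAdd.
- by move=> *; apply: RationalMul.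
- by move=> *; apply: RationalInv; auto.
- by move=> g h _ rg gh; apply: RationalExt rg _; auto.
Qed.

Lemma rational_on_comp U W (phi : E -> E) f :
  rational_map U phi -> (forall X, U X -> W (phi X)) -> rational_on W f ->
  rational_on U (f \o phi).
Proof.
move=> rphi UW; elim => /=.
- by move=> c; exact: RationalCst.
- by move=> i j; exact: rphi.
- by move=> *; apply: RationalAdd.
- by move=> *; apply: RationalMul.
- by move=> g _ rg g0; apply: (RationalInv rg) => X UX; apply: g0; apply: UW.
- by move=> g h _ rg gh; apply: RationalExt rg _ => X UX; apply: gh; apply: UW.
Qed.

Lemma rational_differentiable U f : open U -> rational_on U f ->
  forall X, U X -> differentiable f X.
Proof.
move=> oU; elim.
- by move=> c X _; exact: differentiable_cst.
- by move=> i j X _; exact: differentiable_coord.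
- by move=> g h _ dg _ dh X UX; apply: differentiableD; auto.
- by move=> g h _ dg _ dh X UX; apply: differentiableM; auto.
- by move=> g _ dg g0 X UX; apply: differentiableV; auto.
- move=> g h _ dg gh X UX; apply: near_eq_differentiable (dg X UX).
  by move: (open_nbhs_nbhs (conj oU UX)); apply: filterS.
Qed.

Lemma rational_derive U f v : open U -> rational_on U f ->
  rational_on U (fun X => 'D_v f X).
Proof.
move=> oU rf; elim: {f} rf (rational_differentiable oU rf) => {}.
- move=> c _; apply: RationalExt (RationalCst U 0) _ => X _.
  by rewrite derive_cst.
- move=> i j dc; apply: RationalExt (RationalCst U (v i j)) _ => X UX.
  have dX : derivable (id : E -> E) X v by [].
  have := derive_mx dX; rewrite derive_id => /matrixP/(_ i j).
  by rewrite mxE.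
- move=> f g rf df rg dg _.
  have Df := rational_differentiable oU rf.
  have Dg := rational_differentiable oU rg.
  apply: RationalExt (RationalAdd (df Df) (dg Dg)) _ => X UX.
  by rewrite -deriveD//; apply: diff_derivable; auto.
- move=> f g rf df rg dg _.
  have Df := rational_differentiable oU rf.
  have Dg := rational_differentiable oU rg.
  apply: RationalExt (RationalAdd (RationalMul rf (dg Dg))
    (RationalMul rg (df Df))) _ => X UX.
  by rewrite -[RHS]/('D_v (f * g) X) deriveM//; apply: diff_derivable; auto.
- move=> f rf df f0 _.
  have Df := rational_differentiable oU rf.
  apply: RationalExt (rational_opp (RationalMul (RationalInv
    (RationalMul rf rf) _) (df Df))) _ => X UX.
    by rewrite mulf_neq0// f0.
  rewrite deriveV//; [|exact: f0|by apply: diff_derivable; auto].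
  by rewrite expr2 scaleNr.
- move=> f g rf df fg _.
  apply: RationalExt (df (rational_differentiable oU rf)) _ => X UX.
  apply: near_eq_derive.
  by move: (open_nbhs_nbhs (conj oU UX)); apply: filterS.
Qed.

Lemma mx_differentiable p' q' (phi : E -> 'M[R]_(p', q')) X :
  (forall i j, differentiable (fun Y => phi Y i j) X) -> differentiable phi X.
Proof.
move=> dphi.
have -> : phi = \sum_(i < p') \sum_(j < q')
    (fun Y => phi Y i j *: (delta_mx i j : 'M[R]_(p', q'))).
  apply/funext => Y; rewrite [LHS]matrix_sum_delta fct_sumE.
  by apply: eq_bigr => i _; rewrite fct_sumE.
apply: differentiable_sum => i; apply: differentiable_sum => j.
exact: differentiableZl.
Qed.

Lemma rational_map_smooth U p' q' (phi : E -> 'M[R]_(p', q')) : open U ->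
  rational_map U phi -> smooth_on U phi.
Proof.
move=> oU rphi k; elim: k phi rphi => [|k IH] phi rphi /=.
  move=> X UX; apply: differentiable_continuous; apply: mx_differentiable => i j.
  exact: rational_differentiable (rphi i j) _ UX.
have dphi X : U X -> differentiable phi X.
  move=> UX; apply: mx_differentiable => i j.
  exact: rational_differentiable (rphi i j) _ UX.
split=> // v; apply: IH => i j.
apply: RationalExt (rational_derive v oU (rphi i j)) _ => X UX.
by rewrite derive_mx ?mxE//; apply: diff_derivable; exact: dphi.
Qed.

Lemma rational_continuous U f X : open U -> rational_on U f -> U X ->
  {for X, continuous f}.
Proof.
move=> oU rf UX; apply: differentiable_continuous.
exact: rational_differentiable rf _ UX.
Qed.

Lemma rational_map_continuous U p' q' (phi : E -> 'M[R]_(p', q')) X : open U ->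
  rational_map U phi -> U X -> {for X, continuous phi}.
Proof. by move=> oU /(rational_map_smooth oU)/(_ 0%N)/= /[apply]. Qed.

End Rational.

(** * Triangular charts *)

Section Charts.
Context {R : realType} {p q : nat}.
Local Notation E := 'M[R]_(p, q).
Implicit Types (U W : set E) (phi psi : E -> E).

Definition rational_chart U W phi psi : Prop :=
  [/\ open U /\ open W, rational_map U phi, rational_map W psi,
      forall X, U X -> W (phi X) /\ psi (phi X) = X
    & forall Y, W Y -> U (psi Y) /\ phi (psi Y) = Y].

Lemma rational_chart_diffeomorphism U W phi psi :
  rational_chart U W phi psi -> diffeomorphism U W phi psi.
Proof.
by move=> [[oU oW] rphi rpsi ? ?]; split=> //; exact: rational_map_smooth.
Qed.

Lemma open_preimage U W phi : open U -> rational_map U phi -> open W ->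
  open (U `&` phi @^-1` W).
Proof.
move=> oU rphi oW; rewrite openE => X [UX WX]; apply: filterI.
  exact: open_nbhs_nbhs.
apply: (rational_map_continuous oU rphi UX).
exact: open_nbhs_nbhs.
Qed.

Lemma rational_chart_comp U1 W1 phi1 psi1 U2 W2 phi2 psi2 :
  rational_chart U1 W1 phi1 psi1 -> rational_chart U2 W2 phi2 psi2 ->
  rational_chart (U1 `&` phi1 @^-1` U2) (W2 `&` psi2 @^-1` W1)
    (phi2 \o phi1) (psi1 \o psi2).
Proof.
move=> [[oU1 oW1] rphi1 rpsi1 UW1 WU1] [[oU2 oW2] rphi2 rpsi2 UW2 WU2].
split.
- by split; exact: open_preimage.
- move=> i j; apply: (rational_on_comp (W := U2)) (rphi2 i j).
    by move=> k l; apply: rational_on_subset (rphi1 k l); exact: subIsetl.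
  by move=> X [].
- move=> i j; apply: (rational_on_comp (W := W1)) (rpsi1 i j).
    by move=> k l; apply: rational_on_subset (rpsi2 k l); exact: subIsetl.
  by move=> X [].
- move=> X [/= /UW1[W1X psi1K] /[dup] U2X /UW2[W2X psi2K]].
  by rewrite psi2K.
- move=> Y [/= /WU2[U2Y phi2K] /[dup] W1Y /WU1[U1Y phi1K]].
  by rewrite phi1K.
Qed.

Lemma open_unitmx k (B : E -> 'M[R]_k) : rational_map setT B ->
  open [set X | B X \in unitmx].
Proof.
move=> rB.
have -> : [set X | B X \in unitmx] = (fun X => \det (B X)) @^-1` [set~ 0].
  apply/seteqP; split=> X /=; rewrite unitmxE unitfE; first by move/eqP.
  by move=> h; apply/eqP.
apply: open_comp; last by rewrite openC; exact: closed_eq.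
move=> X _; apply: (rational_continuous openT _ _) => //.
exact: rational_det.
Qed.

Definition set_col (x : 'I_q) (z : 'cV[R]_p) (X : E) : E :=
  \matrix_(i, j) if j == x then z i 0 else X i j.

Lemma col_set_col x y z (X : E) :
  col y (set_col x z X) = if y == x then z else col y X.
Proof. by apply/colP => i; case: eqP => yx; rewrite !mxE ?yx ?eqxx//; case: eqP. Qed.

Lemma set_colE (X Y : E) : (forall y, col y X = col y Y) -> X = Y.
Proof.
by move=> XY; apply/matrixP => i j; move/colP: (XY j) => /(_ i); rewrite !mxE.
Qed.

Lemma rational_set_col U x (z : E -> 'cV[R]_p) :
  rational_map U z -> rational_map U (fun X => set_col x (z X) X).
Proof.
move=> rz i j; case: (altP (j =P x)) => jx.
  by apply: RationalExt (rz i 0) _ => X _; rewrite mxE jx eqxx.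
by apply: RationalExt (RationalCoord U i j) _ => X _; rewrite mxE (negbTE jx).
Qed.

Lemma rational_col U x : rational_map U (fun X : E => col x X).
Proof.
by move=> i j; apply: RationalExt (RationalCoord U i x) _ => X _; rewrite mxE.
Qed.

(** As the matrix acting on a column does not involve that column, the inverse
    of this column operation is given by the inverse matrix. *)
Lemma column_step_chart (x : 'I_q) (B : E -> 'M[R]_p) (e : 'cV[R]_p) :
  rational_map setT B ->
  (forall X Y, (forall y, y != x -> col y X = col y Y) -> B X = B Y) ->
  rational_chart [set X | B X \in unitmx] [set X | B X \in unitmx]
    (fun X => set_col x (B X *m col x X - e) X)
    (fun Y => set_col x (invmx (B Y) *m (col x Y + e)) Y).
Proof.
move=> rB Bx; have Bset z X : B (set_col x z X) = B X.
  by apply: Bx => y /negbTE yx; rewrite col_set_col yx.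
have rBU U : rational_map U B.
  by move=> i j; exact: rational_on_subset (rB i j).
split.
- by split; exact: open_unitmx.
- apply: rational_set_col; apply: rational_add; last exact: rational_cst.
  by apply: rational_mul; [exact: rBU|exact: rational_col].
- apply: rational_set_col; apply: rational_mul; first exact: rational_inv.
  by apply: rational_add; [exact: rational_col|exact: rational_cst].
- move=> X /= uX; rewrite Bset; split=> //; apply: set_colE => y.
  by rewrite !col_set_col eqxx; case: eqP => // ->; rewrite subrK mulKmx.
- move=> Y /= uY; rewrite Bset; split=> //; apply: set_colE => y.
  by rewrite !col_set_col eqxx; case: eqP => // ->; rewrite mulKVmx// addrK.
Qed.

(** Applying the column operations in the order of [t], each one sees later
    columns that are still unmodified; so the composite is given by the same
    formula as the individual steps. *)
Lemma triangular_chart (t : seq 'I_q) (B : 'I_q -> E -> 'M[R]_p)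
    (e : 'I_q -> 'cV[R]_p) (X0 : E) : uniq t ->
  (forall x, rational_map setT (B x)) ->
  (forall x X Y, x \in t ->
     (forall y, (index x t < index y t)%N -> col y X = col y Y) ->
     B x X = B x Y) ->
  (forall x, x \in t -> B x X0 \in unitmx) ->
  exists U W phi psi, [/\ rational_chart U W phi psi, U X0 &
    forall X x, col x (phi X) =
      if x \in t then B x X *m col x X - e x else col x X].
Proof.
move=> + rB; elim: t X0 => [|x t IH] X0 /=.
  move=> _ _ _; exists setT, setT, id, id; split=> //; split=> //.
  - by split; exact: openT.
  - by move=> i j; exact: RationalCoord.
  - by move=> i j; exact: RationalCoord.
move=> /andP[xt ut] Bt uB.
have xB X Y : (forall y, y != x -> col y X = col y Y) -> B x X = B x Y.
  move=> XY; apply: Bt => [|y]; first by rewrite mem_head.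
  by rewrite /= eqxx; case: (altP (x =P y)) => // xy _; apply: XY; rewrite eq_sym.
have tB y X Y : y \in t ->
    (forall z, (index y t < index z t)%N -> col z X = col z Y) -> B y X = B y Y.
  move=> yt XY; apply: Bt => [|z]; first by rewrite inE yt orbT.
  have yx : (x == y) = false by apply: contraNF xt => /eqP->.
  by rewrite /= yx; case: (x == z) => //; rewrite ltnS; exact: XY.
set step := fun X => set_col x (B x X *m col x X - e x) X.
have Bstep y X : y \in t -> B y (step X) = B y X.
  move=> yt; apply: Bt => [|z]; first by rewrite inE yt orbT.
  have yx : (x == y) = false by apply: contraNF xt => /eqP->.
  by rewrite /= yx col_set_col (eq_sym z); case: (x == z).
have [] := IH (step X0) ut tB.
  by move=> y yt; rewrite Bstep//; apply: uB; rewrite inE yt orbT.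
move=> U [W [phi [psi [chart UX0 colphi]]]].
have := rational_chart_comp (column_step_chart (e x) (rB x) xB) chart.
move=> chart'; do 4 eexists; split; first exact: chart'.
  by split=> //=; apply: uB; rewrite mem_head.
move=> X y /=; rewrite colphi inE col_set_col.
case: (altP (y =P x)) => [->|yx] /=; first by rewrite (negbTE xt).
by case: ifPn => // yt; rewrite Bstep.
Qed.

End Charts.

Section CoordinateSubspace.
Context {R : realType} {p q : nat}.
Implicit Types s : seq ('I_p * 'I_q).
Local Notation deltas s := [seq delta_mx a.1 a.2 : 'M[R]_(p, q) | a <- s].

Lemma span_deltasP s (Y : 'M[R]_(p, q)) :
  reflect (forall i j, (i, j) \notin s -> Y i j = 0) (Y \in <<deltas s>>%VS).
Proof.
apply: (iffP idP) => [|Y0].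
  elim: s Y => [|a s IH] Y /=.
    by rewrite span_nil memv0 => /eqP-> i j; rewrite mxE.
  rewrite span_cons => /memv_addP[_ /vlineP[k ->] [Z /IH Z0 ->]] i j.
  rewrite inE negb_or => /andP[ija /Z0 Zij].
  rewrite !mxE Zij addr0.
  by move: ija; case: a => a b; rewrite xpair_eqE /= => /negbTE->; rewrite mulr0.
rewrite (matrix_sum_delta Y); apply: memv_suml => i _; apply: memv_suml => j _.
have [ijs|/Y0->] := boolP ((i, j) \in s); last by rewrite scale0r mem0v.
by apply: memvZ; apply: memv_span; apply/mapP; exists (i, j).
Qed.

Lemma free_deltas s : uniq s -> free (deltas s).
Proof.
elim: s => [|a s IH] /=; first by rewrite nil_free.
move=> /andP[as_ us]; rewrite free_cons IH// andbT.
apply/negP => /span_deltasP/(_ a.1 a.2); rewrite -surjective_pairing => /(_ as_).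
by rewrite mxE !eqxx => /eqP; rewrite oner_eq0.
Qed.

Lemma coordinate_subspace (D : {set 'I_p * 'I_q}) :
  exists2 L : {vspace 'M[R]_(p, q)}, \dim L = #|D| &
    forall Y, Y \in L <-> forall i j, (i, j) \notin D -> Y i j = 0.
Proof.
exists <<deltas (enum D)>>%VS.
  have /eqP-> : free (deltas (enum D)) by rewrite free_deltas ?enum_uniq.
  by rewrite size_map cardE.
move=> Y; split=> [/span_deltasP Y0 i j ijD|Y0].
  by apply: Y0; rewrite mem_enum.
by apply/span_deltasP => i j; rewrite mem_enum; exact: Y0.
Qed.

End CoordinateSubspace.

Section OrderedSystem.
Context {R : realType} {p q : nat}.
Local Notation E := 'M[R]_(p, q).

Lemma rows_unitmx (b : seq 'cV[R]_p) (M : 'M[R]_p) : free b -> size b = p ->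
  (forall r i, M r i = (nth 0 b r) i 0) -> M \in unitmx.
Proof.
move=> fb sb Mb; rewrite -row_free_unit; apply: inj_row_free => v vM0.
move: fb; have -> : b = tcast sb (in_tuple b) by rewrite val_tcast.
move=> /freeP/(_ (fun r => v 0 r)) v0.
apply/rowP => r; rewrite [RHS]mxE; apply: v0.
apply/colP => i; move/rowP: vM0 => /(_ i); rewrite !mxE => vM0.
rewrite -[RHS]vM0 summxE; apply: eq_bigr => s _.
by rewrite mxE Mb val_tcast.
Qed.

Lemma free_complement (b : seq 'cV[R]_p) : free b ->
  exists c : seq 'cV[R]_p, free (b ++ c) /\ size (b ++ c) = p.
Proof.
move=> fb; exists (vbasis <<b>>^C).
have fbc : free (b ++ vbasis <<b>>^C).
  rewrite cat_free fb (basis_free (vbasisP _)) /=.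
  by rewrite (span_basis (vbasisP _)); apply/directv_addP; rewrite capv_compl.
split=> //; move: (fbc) => /eqP <-.
rewrite span_cat (span_basis (vbasisP _)) addv_complf dimvf.
by rewrite /dim /= muln1.
Qed.

(** A system of equations [X_x . X_y = 1], one for every [x] and [y] in [N x],
    is triangular when all of [N x] comes after [x] in some order. Row [r] of
    the matrix acting on column [x] is the [r]-th column of [N x], so that the
    equations become the vanishing of coordinates; constant rows complete the
    matrix to one that is invertible at [X0]. *)
Lemma triangular_system_chart (s : seq 'I_q) (N : 'I_q -> seq 'I_q) (X0 : E) :
  uniq s -> (forall x, x \in s) ->
  (forall x y, y \in N x -> (index x s < index y s)%N) ->
  (forall x, free [seq col y X0 | y <- N x]) ->
  exists U W phi psi (L : {vspace E}), [/\ rational_chart U W phi psi, U X0,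
    (\dim L + \sum_x size (N x) = p * q)%N &
    forall X, phi X \in L <->
      forall x y, y \in N x -> \sum_i X i x * X i y = 1].
Proof.
move=> us sT Ns fN.
have sN x : (size (N x) <= p)%N.
  have := free_complement (fN x) => -[c [_ <-]].
  by rewrite size_cat size_map leq_addr.
pose c x := projT1 (cid (free_complement (fN x))).
have [fc sc] : (forall x, free ([seq col y X0 | y <- N x] ++ c x)) /\
    forall x, size ([seq col y X0 | y <- N x] ++ c x) = p.
  by split=> x; rewrite /c; case: cid => ? [].
pose B x (X : E) : 'M[R]_p := \matrix_(r, i)
  (if (r < size (N x))%N then X i (nth x (N x) r)
   else nth 0 (c x) (r - size (N x)) i 0).
pose e x : 'cV[R]_p := \col_r (r < size (N x))%:R.
have rB x : rational_map setT (B x).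
  move=> r i; case: (ltnP r (size (N x))) => rN.
    apply: RationalExt (RationalCoord _ i (nth x (N x) r)) _ => X _.
    by rewrite mxE rN.
  apply: RationalExt (RationalCst _ (nth 0 (c x) (r - size (N x)) i 0)) _ => X _.
  by rewrite mxE ltnNge rN.
have Bs x X Y : x \in s ->
    (forall y, (index x s < index y s)%N -> col y X = col y Y) -> B x X = B x Y.
  move=> _ XY; apply/matrixP => r i; rewrite !mxE; case: ifP => // rN.
  have /colP/(_ i) := XY _ (Ns _ _ (mem_nth x rN)).
  by rewrite !mxE.
have uB x : x \in s -> B x X0 \in unitmx.
  move=> _; apply: rows_unitmx (fc x) (sc x) _ => r i.
  rewrite mxE nth_cat size_map; case: ifP => // rN.
  by rewrite (nth_map x)// mxE.
have [U [W [phi [psi [chart UX0 colphi]]]]] := triangular_chart e us rB Bs uB.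
pose D := [set a : 'I_p * 'I_q | (size (N a.2) <= a.1)%N]%SET.
have [L dL LP] := @coordinate_subspace R p q D.
exists U, W, phi, psi, L; split=> //.
  rewrite dL -sum1_card (eq_bigl (fun a : 'I_p * 'I_q => (size (N a.2) <= a.1)%N)); last first.
    by move=> a; rewrite inE.
  rewrite -(pair_big_dep xpredT (fun (r : 'I_p) x => (size (N x) <= r)%N) (fun _ _ => 1%N)).
  rewrite (exchange_big_dep xpredT)//= -big_split /= mulnC -[in RHS](card_ord q) -sum_nat_const.
  apply: eq_bigr => x _; rewrite sum1_card.
  have := cardC (fun r : 'I_p => (size (N x) <= r)%N); rewrite card_ord => pE.
  rewrite -[RHS]pE.
  congr (_ + _)%N.
  have iE : #|fintype.image (widen_ord (sN x)) predT| = size (N x).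
    rewrite fintype.card_image ?card_ord// => a b /(congr1 val)/= ab; exact: val_inj.
  rewrite -[LHS]iE; apply: fintype.eq_card => r; rewrite !inE -ltnNge; apply/idP/idP.
    by move/fintype.imageP => [a _ ->] /=; exact: ltn_ord.
  move=> rN; apply/fintype.imageP; exists (Ordinal rN) => //; exact: val_inj.
have phiE X x (r : 'I_p) : (r < size (N x))%N ->
    phi X r x = \sum_i X i x * X i (nth x (N x) r) - 1.
  move=> rN; have /colP/(_ r) := colphi X x; rewrite sT !mxE rN => ->.
  by congr (_ - _); apply: eq_bigr => i _; rewrite !mxE rN mulrC.
move=> X; rewrite LP; split=> [phi0 x y yN|X1 r x].
  have yN' : (index y (N x) < size (N x))%N by rewrite index_mem.
  have yp : (index y (N x) < p)%N by exact: leq_trans yN' (sN x).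
  have := phi0 (Ordinal yp) x; rewrite inE /= -ltnNge phiE//= nth_index//.
  by move=> /(_ yN')/eqP; rewrite subr_eq0 => /eqP.
rewrite inE /= -ltnNge => rN; rewrite phiE// X1 ?subrr//; exact: mem_nth.
Qed.

End OrderedSystem.

(** * Linear inequalities *)

Section Farkas.
Context {R : realFieldType}.

Definition dot d (c x : 'cV[R]_d) : R := (c^T *m x) 0 0.

Section DotTheory.
Context {d : nat}.
Implicit Types c x y z : 'cV[R]_d.

Lemma dotE c x : dot c x = \sum_i c i 0 * x i 0.
Proof. by rewrite /dot mxE; apply: eq_bigr => i _; rewrite mxE. Qed.

Lemma dotC c x : dot c x = dot x c.
Proof. by rewrite !dotE; apply: eq_bigr => i _; rewrite mulrC. Qed.

Lemma dotDr c x y : dot c (x + y) = dot c x + dot c y.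
Proof. by rewrite /dot mulmxDr mxE. Qed.

Lemma dotDl x y c : dot (x + y) c = dot x c + dot y c.
Proof. by rewrite dotC dotDr !(dotC c). Qed.

Lemma dotZr c k x : dot c (k *: x) = k * dot c x.
Proof. by rewrite /dot -scalemxAr mxE. Qed.

Lemma dotZl c k x : dot (k *: c) x = k * dot c x.
Proof. by rewrite dotC dotZr dotC. Qed.

Lemma dotNr c x : dot c (- x) = - dot c x.
Proof. by rewrite -scaleN1r dotZr mulN1r. Qed.

Lemma dotNl c x : dot (- c) x = - dot c x.
Proof. by rewrite -scaleN1r dotZl mulN1r. Qed.

Lemma dot0r c : dot c 0 = 0.
Proof. by rewrite /dot mulmx0 mxE. Qed.

Lemma dot0l c : dot 0 c = 0.
Proof. by rewrite dotC dot0r. Qed.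

Lemma dot_sumr (I : finType) c (F : I -> 'cV[R]_d) :
  dot c (\sum_i F i) = \sum_i dot c (F i).
Proof.
by rewrite /dot mulmx_sumr summxE.
Qed.

Lemma dot_combr (I : finType) c (l : I -> R) (F : I -> 'cV[R]_d) :
  dot c (\sum_i l i *: F i) = \sum_i l i * dot c (F i).
Proof. by rewrite dot_sumr; apply: eq_bigr => i _; rewrite dotZr. Qed.

Lemma dot_combl (I : finType) c (l : I -> R) (F : I -> 'cV[R]_d) :
  dot (\sum_i l i *: F i) c = \sum_i l i * dot (F i) c.
Proof. by rewrite dotC dot_combr; apply: eq_bigr => i _; rewrite dotC. Qed.

Lemma dot_self_gt0 x : x != 0 -> 0 < dot x x.
Proof.
move=> x0; rewrite lt_neqAle eq_sym dotE sumr_ge0 ?andbT; last first.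
  by move=> i _; rewrite -expr2 sqr_ge0.
apply: contra x0 => /eqP s0; apply/eqP/colP => i; rewrite mxE.
have sq (j : 'I_d) : true -> 0 <= x j 0 * x j 0 by rewrite -expr2 sqr_ge0.
by have /eqP := @psumr_eq0P _ _ _ _ sq s0 i isT; rewrite mulf_eq0 orbb => /eqP.
Qed.

Lemma dot_eq0 x : (forall y, dot x y = 0) -> x = 0.
Proof.
move=> x0; apply/eqP; apply/negP => /negP/dot_self_gt0.
by rewrite x0 ltxx.
Qed.

End DotTheory.

(** Bartl's induction: if some [c] separates [y] from all but the first vector,
    scaled to take the value 1 on that vector, then subtracting from every
    vector the multiple of the first one that brings it into the kernel of [c]
    removes the first vector from the problem. *)
Lemma farkas d k (u : 'I_k -> 'cV[R]_d) y :
  (exists2 l : 'I_k -> R, forall i, 0 <= l i & y = \sum_i l i *: u i) \/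
  (exists2 c, forall i, dot c (u i) <= 0 & 0 < dot c y).
Proof.
elim: k u y => [|k IH] u y.
  have [->|y0] := eqVneq y 0.
    by left; exists (fun=> 0) => //; rewrite big_ord0.
  by right; exists y; [case|exact: dot_self_gt0].
have [[l l0 ->]|[c cu cy]] := IH (u \o lift ord0) y.
  left; exists (fun i => if unlift ord0 i is Some j then l j else 0).
    by move=> i; case: unlift.
  rewrite big_ord_recl unlift_none scale0r add0r.
  by apply: eq_bigr => i _; rewrite liftK.
have [cu0|cu0] := leP (dot c (u ord0)) 0.
  right; exists c => // i; case: (unliftP ord0 i) => [j|] -> //; exact: cu.
pose cb := (dot c (u ord0))^-1 *: c.
have cb0 : dot cb (u ord0) = 1 by rewrite dotZl mulVf// gt_eqF.
have cbu i : dot cb (u (lift ord0 i)) <= 0.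
  by rewrite dotZl pmulr_rle0 ?invr_gt0//; exact: cu.
have cby : 0 < dot cb y by rewrite dotZl mulr_gt0 ?invr_gt0.
clearbody cb; pose u' i := u (lift ord0 i) - dot cb (u (lift ord0 i)) *: u ord0.
have [[l l0 yl]|[c' cu' cy']] := IH u' (y - dot cb y *: u ord0).
  pose s := dot cb y - \sum_i l i * dot cb (u (lift ord0 i)).
  left; exists (fun i => if unlift ord0 i is Some j then l j else s).
    move=> i; case: unlift => // ; rewrite subr_ge0 (le_trans _ (ltW cby))//.
    by apply: sumr_le0 => j _; rewrite mulr_ge0_le0.
  rewrite big_ord_recl unlift_none.
  have -> : \sum_(i < k) (if unlift ord0 (lift ord0 i) is Some j then l j else s)
      *: u (lift ord0 i) = \sum_i l i *: u (lift ord0 i).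
    by apply: eq_bigr => i _; rewrite liftK.
  move: yl; under eq_bigr => i _ do rewrite scalerBr scalerA.
  rewrite sumrB -scaler_suml => /(canRL (subrK _)) ->.
  by rewrite /s scalerBl [RHS]addrC -addrA [- _ + _]addrC.
right; exists (c' - dot c' (u ord0) *: cb).
  move=> i; case: (unliftP ord0 i) => [j|] ->.
    have := cu' j; rewrite dotDr dotNr dotZr => h.
    by rewrite dotDl dotNl dotZl mulrC.
  by rewrite dotDl dotNl dotZl cb0 mulr1 subrr.
by move: cy'; rewrite dotDr dotNr dotZr dotDl dotNl dotZl [dot c' (u ord0) * _]mulrC.
Qed.

(** Appending a coordinate 1 to all vectors turns convex combinations into conic
    ones. *)
Lemma farkas_affine d k (u : 'I_k -> 'cV[R]_d) y :
  (exists l : 'I_k -> R, [/\ forall i, 0 <= l i, \sum_i l i = 1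
     & y = \sum_i l i *: u i]) \/
  (exists c b, (forall i, dot c (u i) <= b) /\ b < dot c y).
Proof.
pose h (x : 'cV[R]_d) : 'cV[R]_(d + 1) := col_mx x (const_mx 1).
have dot_h (c : 'cV[R]_(d + 1)) x :
    dot c (h x) = dot (usubmx c) x + (dsubmx c) 0 0.
  rewrite -[in LHS](vsubmxK c) /dot tr_col_mx mul_row_col mxE; congr (_ + _).
  by rewrite mxE big_ord1 !mxE mulr1.
have [[l l0 hy]|[c cu cy]] := farkas (fun i => h (u i)) (h y).
  left; exists l; split => //.
    move/(congr1 dsubmx)/colP/(_ 0): hy; rewrite col_mxKd mxE linear_sum summxE.
    by move=> ->; apply: eq_bigr => i _; rewrite linearZ /= col_mxKd !mxE mulr1.
  move/(congr1 usubmx): hy; rewrite col_mxKu linear_sum => ->.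
  by apply: eq_bigr => i _; rewrite linearZ /= col_mxKu.
right; exists (usubmx c), (- (dsubmx c) 0 0); split.
  by move=> i; have := cu i; rewrite dot_h -lerBrDr sub0r.
by rewrite -subr_gt0 opprK -dot_h.
Qed.

Lemma small_step m (al be : 'I_m -> R) : (forall j, al j < 1) ->
  exists2 e, 0 < e & forall t, 0 < t <= e -> forall j, al j + t * be j < 1.
Proof.
move=> al1; pose F j := (1 - al j) / (`|be j| + 1).
have be0 j : 0 < `|be j| + 1 by rewrite ltr_wpDl.
have F0 j : 0 < F j by rewrite divr_gt0// subr_gt0.
exists (\big[Num.min/1]_j F j); first by apply: lt_bigmin.
move=> t /andP[t0 tF] j; rewrite -ltrBrDl.
have tj : t <= F j by apply: le_trans tF _; exact: bigmin_le_cond.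
rewrite (@le_lt_trans _ _ (t * `|be j|))//.
  by rewrite ler_pM2l// ler_norm.
rewrite (@lt_le_trans _ _ (t * (`|be j| + 1)))//.
  by rewrite ltr_pM2l// ltrDl.
by rewrite -ler_pdivlMr.
Qed.

End Farkas.

(** * Hulls of columns *)

Section Hulls.
Context {R : realType} {d n m : nat}.
Implicit Types (V : 'M[R]_(d, n)) (A : 'M[R]_(d, m)) (I : {set 'I_n}).
Local Notation hull V I := (convex_hull [set x | exists2 i, i \in I & x = col i V]).

Lemma hullP V I x : hull V I x <-> exists l : 'I_n -> R,
  [/\ forall i, 0 <= l i, forall i, i \notin I -> l i = 0, \sum_i l i = 1 &
      x = \sum_i l i *: col i V].
Proof.
split=> [[k [p [c [pI c0 c1 ->]]]]|[l [l0 lI l1 ->]]].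
  pose f a := sval (cid2 (pI a)).
  have fI a : f a \in I by rewrite /f; case: cid2.
  have pE a : p a = col (f a) V by rewrite /f; case: cid2.
  exists (fun i => \sum_(a | f a == i) c a); split.
  - by move=> i; apply: sumr_ge0.
  - by move=> i iI; rewrite big1// => a /eqP fa; rewrite -fa fI in iI.
  - by rewrite -c1 (partition_big f xpredT).
  - rewrite (partition_big f xpredT)//=; apply: eq_bigr => i _.
    by rewrite scaler_suml; apply: eq_bigr => a /eqP <-; rewrite pE.
have [i0 i0I] : exists i, i \in I.
  apply: contrapT => nI; have : \sum_i l i = 0.
    by apply: big1 => i _; apply: lI; apply/negP => iI; apply: nI; exists i.
  by rewrite l1 => /eqP; rewrite oner_eq0.
exists n, (fun i => col (if i \in I then i else i0) V), l; split=> //.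
  by move=> i; exists (if i \in I then i else i0) => //; case: ifP.
by apply: eq_bigr => i _; case: ifPn => // /lI->; rewrite !scale0r.
Qed.

Lemma conv_cols_hull V : conv_cols V = hull V [set: 'I_n]%SET.
Proof.
rewrite /conv_cols; congr convex_hull; apply/seteqP.
by split=> x /= [i _ ix]; exists i => //; rewrite inE.
Qed.

Lemma conv_colsP V x : conv_cols V x <-> exists l : 'I_n -> R,
  [/\ forall i, 0 <= l i, \sum_i l i = 1 & x = \sum_i l i *: col i V].
Proof.
rewrite conv_cols_hull hullP; split=> [] [l]; first by case=> l0 _ l1 xl; exists l.
by case=> l0 l1 xl; exists l; split=> // i; rewrite inE.
Qed.

Lemma conv_cols_col V i : conv_cols V (col i V).
Proof.
apply/conv_colsP; exists (fun k => (k == i)%:R); split=> //.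
  by rewrite (bigD1 i)//= eqxx big1 ?addr0// => k /negbTE->.
rewrite (bigD1 i)//= eqxx scale1r big1 ?addr0// => k /negbTE->.
by rewrite scale0r.
Qed.

Lemma hull_set1 V i : hull V [set i]%SET = [set col i V].
Proof.
apply/seteqP; split=> x /=.
  move=> /hullP[l [_ lI l1 ->]].
  have E k : k != i -> l k = 0 by move=> ki; apply: lI; rewrite inE.
  rewrite (bigD1 i)//= big1 => [|k /E->]; last by rewrite scale0r.
  suff -> : l i = 1 by rewrite scale1r addr0.
  by rewrite -l1 (bigD1 i)//= big1 ?addr0// => k /E.
move=> ->; apply/hullP; exists (fun k => (k == i)%:R); split=> //.
- by move=> k; rewrite inE => /negbTE->.
- by rewrite (bigD1 i)//= eqxx big1 ?addr0// => k /negbTE->.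
- rewrite (bigD1 i)//= eqxx scale1r big1 ?addr0// => k /negbTE->.
  by rewrite scale0r.
Qed.

Lemma halfspaces_row A j x : (A^T *m x) j 0 = dot (col j A) x.
Proof. by rewrite mxE dotE; apply: eq_bigr => i _; rewrite !mxE. Qed.

Lemma halfspacesE A x : halfspaces A x <-> forall j, dot (col j A) x <= 1.
Proof.
by split=> h j; have := h j; rewrite halfspaces_row.
Qed.

Lemma hull_sub_halfspaces V A : (forall i j, dot (col j A) (col i V) <= 1) ->
  conv_cols V `<=` halfspaces A.
Proof.
move=> VA x /conv_colsP[l [l0 l1 ->]]; apply/halfspacesE => j.
rewrite dot_combr -[leRHS]l1; apply: ler_sum => i _.
by rewrite -[leRHS]mulr1 ler_wpM2l.
Qed.

(** ** Recovering the inequalities from the vertices *)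

Definition active c V : {set 'I_n} := [set i | dot c (col i V) == 1]%SET.

Lemma positive_relation_eq0 V (w : 'I_n -> R) z :
  (forall i, 0 < w i) -> \sum_i w i *: col i V = 0 ->
  (forall i, dot z (col i V) <= 0) -> forall i, dot z (col i V) = 0.
Proof.
move=> w0 wV zV i.
have ge0 (j : 'I_n) : true -> 0 <= w j * - dot z (col j V).
  by move=> _; rewrite mulr_ge0 ?oppr_ge0// ltW.
have sum0 : \sum_j w j * - dot z (col j V) = 0.
  under eq_bigr => j _ do rewrite mulrN.
  by rewrite sumrN -dot_combr wV dot0r oppr0.
have /eqP := @psumr_eq0P _ _ _ _ ge0 sum0 i isT.
by rewrite mulf_eq0 gt_eqF//= oppr_eq0 => /eqP.
Qed.

(** A [c] whose set of active columns is largest is a vertex of the polar: if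
    the active columns were all orthogonal to some [z != 0], moving [c] along
    [z] or [- z], whichever does not decrease [dot c y], would eventually
    activate one more column. *)
Lemma polar_vertex V (w : 'I_n -> R) y c0 :
  (forall i, 0 < w i) -> \sum_i w i *: col i V = 0 ->
  (forall c, (forall i, dot c (col i V) = 0) -> c = 0) ->
  (forall i, dot c0 (col i V) <= 1) -> 1 < dot c0 y ->
  exists c, [/\ forall i, dot c (col i V) <= 1, 1 < dot c y &
    forall z, (forall i, i \in active c V -> dot z (col i V) = 0) -> z = 0].
Proof.
move=> w0 wV Vspan; have [k] := ubnP (n - #|active c0 V|).
elim: k c0 => // k IH c nk cV cy.
have [[z zV z0]|nz] := pselect (exists2 z,
    forall i, i \in active c V -> dot z (col i V) = 0 & z != 0); last first.
  exists c; split=> // z zV; apply: contrapT => /eqP z0; apply: nz.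
  by exists z.
wlog zy : z zV z0 / 0 <= dot z y.
  move=> W; have [|zy] := leP 0 (dot z y); first exact: W.
  apply: (W (- z)); rewrite ?oppr_eq0 ?dotNl ?oppr_ge0 ?(ltW zy)//.
  by move=> i /zV zi; rewrite dotNl zi oppr0.
have [i0 zi0] : exists i, 0 < dot z (col i V).
  apply: contrapT => nex; move/eqP: z0; apply; apply: Vspan.
  apply: (positive_relation_eq0 w0 wV) => j.
  by rewrite leNgt; apply/negP => zj; apply: nex; exists j.
(* F i is the length of the step along z that makes column i active. *)
pose F i := (1 - dot c (col i V)) / dot z (col i V).
have [i1 zi1 Fmin] : exists2 i, 0 < dot z (col i V) &
    forall k, 0 < dot z (col k V) -> F i <= F k.
  by case: (@arg_minP _ _ _ i0 (fun i => 0 < dot z (col i V)) F zi0) => i; exists i.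
have F0 : 0 <= F i1 by rewrite divr_ge0 ?subr_ge0 ?(ltW zi1).
have i1c : i1 \notin active c V by apply: contraTN zi1 => /zV->; rewrite ltxx.
apply: (IH (c + F i1 *: z)).
- have : active c V \proper active (c + F i1 *: z) V.
    rewrite properE; apply/andP; split.
      apply/fintype.subsetP => i ic; rewrite inE dotDl dotZl (zV _ ic) mulr0 addr0.
      by move: ic; rewrite inE.
    apply/fintype.subsetPn; exists i1 => //.
    by rewrite inE dotDl dotZl (divfK (lt0r_neq0 zi1)) subrKC.
  move=> /proper_card lt; rewrite -ltnS; apply: leq_trans nk; rewrite ltnS.
  by rewrite ltn_sub2l//; apply: leq_trans lt _; rewrite -[leqRHS]card_ord max_card.
- move=> i; rewrite dotDl dotZl; have [zi|zi] := leP (dot z (col i V)) 0.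
    by rewrite -[leRHS]addr0 lerD// mulr_ge0_le0.
  by rewrite -lerBrDl -ler_pdivlMr// Fmin.
- by rewrite dotDl dotZl (lt_le_trans cy)// lerDl mulr_ge0.
Qed.

(** A point outside the hull is cut off by a vertex [c] of the polar. If some
    column of [A] agrees with [c] on its active columns, it equals [c], because
    these span the space; so it cuts the point off as well. *)
Lemma halfspaces_sub_hull V A (w : 'I_n -> R) (n0 : (0 < n)%N) :
  (forall i, 0 < w i) -> \sum_i w i *: col i V = 0 ->
  (forall c, (forall i, dot c (col i V) = 0) -> c = 0) ->
  (forall c, (forall i, dot c (col i V) <= 1) -> active c V != finset.set0 ->
     exists j, forall i, i \in active c V -> dot (col j A) (col i V) = 1) ->
  halfspaces A `<=` conv_cols V.
Proof.
move=> w0 wV Vspan VA y /halfspacesE Ay.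
have [[l [l0 l1 yl]]|[c [b [cb by_]]]] := farkas_affine (fun i => col i V) y.
  by apply/conv_colsP; exists l.
exfalso.
have [b0|b0] := leP b 0.
  have cV i : dot c (col i V) = 0.
    by apply: (positive_relation_eq0 w0 wV) => k; exact: le_trans (cb k) b0.
  have c0 := Vspan _ cV; move: by_; rewrite c0 dot0l => b_lt0.
  by have := cb (Ordinal n0); rewrite c0 dot0l leNgt b_lt0.
have c1 i : dot (b^-1 *: c) (col i V) <= 1.
  by rewrite dotZl mulrC ler_pdivrMr// mul1r.
have cy1 : 1 < dot (b^-1 *: c) y by rewrite dotZl mulrC ltr_pdivlMr// mul1r.
have [c' [c'V c'y c'span]] := polar_vertex w0 wV Vspan c1 cy1.
have actN0 : active c' V != finset.set0.
  apply/eqP => act0; move: c'y.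
  by rewrite (c'span c') ?dot0l ?ltr10// => i; rewrite act0 inE.
have [j jV] := VA _ c'V actN0.
suff /eqP : col j A - c' = 0.
  by rewrite subr_eq0 => /eqP jc; have := Ay j; rewrite jc leNgt c'y.
apply: c'span => i ic; rewrite dotDl dotNl jV//.
by move: ic; rewrite inE => /eqP->; rewrite subrr.
Qed.

End Hulls.

(** * Faces of a polytope given by both descriptions *)

Section Faces.
Context {R : realType} {d n m : nat}.
Implicit Types (V : 'M[R]_(d, n)) (A : 'M[R]_(d, m)) (I : {set 'I_n}).
Implicit Types (F : set 'cV[R]_d).
Local Notation hull V I := (convex_hull [set x | exists2 i, i \in I & x = col i V]).

Definition tight V A (i : 'I_n) (j : 'I_m) : bool := dot (col j A) (col i V) == 1.

Definition face_vertices V F : {set 'I_n} := [set i | `[< F (col i V) >]]%SET.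

Definition facet_of V A j : set 'cV[R]_d :=
  [set x | conv_cols V x /\ (A^T *m x) j 0 = 1].

Definition incidence_closed (inc : 'I_n -> 'I_m -> bool) I : Prop :=
  forall i, (forall j, (forall k, k \in I -> inc k j) -> inc i j) -> i \in I.

Lemma face_verticesP V F i : i \in face_vertices V F <-> F (col i V).
Proof. by rewrite inE; split=> /asboolP. Qed.

Lemma face_hull V F : face (conv_cols V) F -> F = hull V (face_vertices V F).
Proof.
move=> [c [b [cb FE]]]; apply/seteqP; split=> x.
  rewrite {1}FE => -[/conv_colsP[l [l0 l1 xl]] cx].
  apply/hullP; exists l; split=> // i iF.
  have ge0 (k : 'I_n) : true -> 0 <= l k * (b - dot c (col k V)).
    by move=> _; rewrite mulr_ge0// subr_ge0; apply: cb; exact: conv_cols_col.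
  have sum0 : \sum_k l k * (b - dot c (col k V)) = 0.
    under eq_bigr => k _ do rewrite mulrBr.
    by rewrite sumrB -mulr_suml l1 mul1r -dot_combr -xl; apply/eqP; rewrite subr_eq0 -cx.
  have /eqP := @psumr_eq0P _ _ _ _ ge0 sum0 i isT.
  rewrite mulf_eq0 => /orP[/eqP//|]; rewrite subr_eq0 => /eqP ci.
  suff : i \in face_vertices V F by rewrite (negbTE iF).
  by apply/face_verticesP; rewrite FE; split=> //; exact: conv_cols_col.
move=> /hullP[l [l0 lF l1 xl]]; rewrite FE; split.
  by apply/conv_colsP; exists l.
rewrite xl -[LHS]/(dot c _) dot_combr.
transitivity (\sum_i l i * b); last by rewrite -mulr_suml l1 mul1r.
apply: eq_bigr => i _; have [|/lF->] := boolP (i \in face_vertices V F).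
  by move/face_verticesP; rewrite FE => -[_ ci]; rewrite /dot ci.
by rewrite !mul0r.
Qed.

Lemma face_conv_cols V : face (conv_cols V) (conv_cols V).
Proof.
exists 0, 0; split=> [x _|]; first by rewrite -[leLHS]/(dot 0 x) dot0l.
apply/seteqP; split=> [x Kx|x []//]; split=> //.
by rewrite -[LHS]/(dot 0 x) dot0l.
Qed.

Lemma sub_face V F G : face (conv_cols V) F -> face (conv_cols V) G ->
  (F `<=` G <-> face_vertices V F \subset face_vertices V G).
Proof.
move=> fF fG; split=> [FG|/fintype.subsetP FG].
  by apply/fintype.subsetP => i /face_verticesP/FG/face_verticesP.
rewrite (face_hull fF) (face_hull fG) => x /hullP[l [l0 lF l1 xl]].
apply/hullP; exists l; split=> // i iG; apply: lF.
by apply: contra iG; exact: FG.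
Qed.

Lemma face_vertices_inj V F G : face (conv_cols V) F -> face (conv_cols V) G ->
  face_vertices V F = face_vertices V G -> F = G.
Proof. by move=> /face_hull {2}-> /face_hull {2}-> ->. Qed.

Section BothDescriptions.
Context V A (VA : conv_cols V = halfspaces A).

Lemma dot_cols_le i j : dot (col j A) (col i V) <= 1.
Proof. by have := conv_cols_col V i; rewrite VA => /halfspacesE. Qed.

Lemma conv_cols0 : conv_cols V 0.
Proof. by rewrite VA; apply/halfspacesE => j; rewrite dot0r. Qed.

(** Scaling [x] up and then moving it against the sum of all vertices stays
    inside the polytope; a convex representation of the resulting point gives
    one of [x] with positive weights of total less than 1. *)
Lemma interior_positive_comb x : (forall j, dot (col j A) x < 1) ->
  exists w : 'I_n -> R, [/\ forall i, 0 < w i, \sum_i w i < 1 &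
    x = \sum_i w i *: col i V].
Proof.
move=> x1; pose s : 'cV[R]_d := \sum_i col i V.
have [t t0 tP] := small_step (fun j => dot (col j A) x) x1.
have t1 j : dot (col j A) ((1 + t) *: x) < 1.
  rewrite dotZr mulrDl mul1r; apply: tP; by rewrite t0 lexx.
have [e e0 eP] := small_step (fun j => dot (col j A) (- s)) t1.
(* The bound t / (n + 1) makes the weight n * k that is added at the end
   smaller than the t gained by scaling. *)
pose k := Num.min e (t / (n%:R + 1)).
have n0 : (0 : R) < n%:R + 1 by rewrite ltr_wpDl.
have k0 : 0 < k by rewrite lt_min e0 divr_gt0.
have ke : k <= e by rewrite ge_min lexx.
have nk : n%:R * k < t.
  apply: (@lt_le_trans _ _ ((n%:R + 1) * k)); first by rewrite ltr_pM2r// ltrDl.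
  by rewrite mulrC -ler_pdivlMr// ge_min lexx orbT.
have : conv_cols V ((1 + t) *: x - k *: s).
  rewrite VA; apply/halfspacesE => j; apply/ltW.
  rewrite dotDr -scalerN [dot _ (k *: _)]dotZr; apply: eP; by rewrite k0.
move=> /conv_colsP[l [l0 l1 xl]].
have t1_0 : 0 < 1 + t by rewrite addr_gt0.
exists (fun i => (1 + t)^-1 * (l i + k)); split.
- by move=> i; rewrite mulr_gt0 ?invr_gt0// ltr_wpDl.
- rewrite -mulr_sumr big_split /= l1 sumr_const card_ord mulrC ltr_pdivrMr// mul1r.
  by rewrite ltrD2l -mulr_natl.
- have -> : x = (1 + t)^-1 *: ((1 + t) *: x - k *: s + k *: s).
    by rewrite subrK scalerA mulVf ?scale1r// gt_eqF.
  rewrite xl /s scaler_sumr -big_split scaler_sumr; apply: eq_bigr => i _ /=.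
  by rewrite -scalerDl scalerA.
Qed.

Lemma dot_vertices_eq0 c : (forall i, dot c (col i V) = 0) -> c = 0.
Proof.
move=> cV; have lt1 : forall j : 'I_m, (0 : R) < 1 by [].
have [e e0 eP] := small_step (fun j => dot (col j A) c) lt1.
have : conv_cols V (e *: c).
  rewrite VA; apply/halfspacesE => j; apply/ltW; rewrite dotZr -[ltLHS]add0r.
  by apply: eP; rewrite e0 lexx.
move=> /conv_colsP[l [_ _ ecl]]; apply/eqP; apply: contraT => /dot_self_gt0.
have := congr1 (dot c) ecl; rewrite dotZr dot_combr big1 => [|i _]; last first.
  by rewrite cV mulr0.
by move=> /eqP; rewrite mulf_eq0 gt_eqF//= => /eqP->; rewrite ltxx.
Qed.

(** Along a ray, [dot z] would exceed its maximum over the vertices. *)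
Lemma recession_eq0 z : (forall j, dot (col j A) z <= 0) -> z = 0.
Proof.
move=> Az; apply/eqP; apply: contraT => /dot_self_gt0 zz.
pose C := \sum_i `|dot z (col i V)|.
have C0 : 0 <= C by apply: sumr_ge0.
pose t := (C + 1) / dot z z.
have t0 : 0 <= t by rewrite divr_ge0 ?addr_ge0// ltW.
have : conv_cols V (t *: z).
  rewrite VA; apply/halfspacesE => j; rewrite dotZr.
  by apply: (le_trans _ (ler01)); rewrite mulr_ge0_le0.
move=> /conv_colsP[l [l0 l1 tl]].
have := congr1 (dot z) tl; rewrite dotZr divfK ?gt_eqF// dot_combr => E.
have : C + 1 <= C.
  rewrite E; apply: ler_sum => i _; apply: (@le_trans _ _ (l i * `|dot z (col i V)|)).
    by rewrite ler_wpM2l// ler_norm.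
  rewrite -[leRHS]mul1r ler_wpM2r// -l1 (bigD1 i)//= lerDl; exact: sumr_ge0.
by rewrite -lerBrDl subrr ler10.
Qed.

(** If [c] were not in the cone of the inequalities that are tight at [x],
    Farkas' lemma would give a direction along which one can leave [x] inside
    the polyhedron and increase [c]. *)
Lemma supporting_cone x c : halfspaces A x ->
  (forall y, halfspaces A y -> dot c y <= dot c x) ->
  exists l : 'I_m -> R, [/\ forall j, 0 <= l j,
    forall j, dot (col j A) x != 1 -> l j = 0 & c = \sum_j l j *: col j A].
Proof.
move=> /halfspacesE Ax cx; pose t j := dot (col j A) x == 1.
have [[l l0 cl]|[z zA zc]] :=
    farkas (fun j => if t j then col j A else 0) c.
  exists (fun j => if t j then l j else 0); split.
  - by move=> j; case: ifP.
  - by move=> j /negbTE tj; rewrite /t tj.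
  - rewrite cl; apply: eq_bigr => j _; case: ifP => // _.
    by rewrite scaler0 scale0r.
have lt1 j : (if t j then 0 else dot (col j A) x) < 1.
  by rewrite /t; case: eqP => // /eqP ne; rewrite lt_neqAle ne Ax.
have [e e0 eP] := small_step (fun j => if t j then 0 else dot (col j A) z) lt1.
have /cx : halfspaces A (x + e *: z).
  apply/halfspacesE => j; have := eP e; rewrite e0 lexx => /(_ isT j).
  have := zA j; rewrite dotDr dotZr /t; case: eqP => [-> zj _|_ _ /ltW//].
  by rewrite -[leRHS]addr0 lerD// mulr_ge0_le0 ?(ltW e0)// dotC.
by rewrite dotDr dotZr gerDl leNgt mulr_gt0// dotC.
Qed.

End BothDescriptions.

Definition barycenter V I : 'cV[R]_d := \sum_(i in I) (#|I|%:R)^-1 *: col i V.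

Lemma dot_barycenter V c I :
  dot c (barycenter V I) = (#|I|%:R)^-1 * \sum_(i in I) dot c (col i V).
Proof.
rewrite /barycenter /dot mulmx_sumr summxE mulr_sumr.
by apply: eq_bigr => i _; rewrite -scalemxAr mxE.
Qed.

Lemma dot_barycenter_eq V c b I : I != finset.set0 ->
  (forall i, i \in I -> dot c (col i V) = b) -> dot c (barycenter V I) = b.
Proof.
move=> I0 cb; rewrite dot_barycenter (eq_bigr (fun=> b))// sumr_const.
by rewrite -[b *+ _]mulr_natl mulKf// pnatr_eq0 cards_eq0.
Qed.

Lemma dot_barycenter_lt V c b I : (forall i, i \in I -> dot c (col i V) <= b) ->
  (exists2 i, i \in I & dot c (col i V) < b) -> dot c (barycenter V I) < b.
Proof.
move=> cb [i iI ci]; rewrite dot_barycenter.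
have I0 : (0 : R) < #|I|%:R by rewrite ltr0n; apply/card_gt0P; exists i.
rewrite mulrC ltr_pdivrMr// mulr_natr -sumr_const.
rewrite (bigD1 i)//= [ltRHS](bigD1 i)//= ltr_leD//.
by apply: ler_sum => k /andP[/cb].
Qed.

Lemma conv_cols_barycenter V I : I != finset.set0 -> conv_cols V (barycenter V I).
Proof.
move=> I0; have n0 : #|I|%:R != 0 :> R by rewrite pnatr_eq0 cards_eq0.
apply/conv_colsP; exists (fun i => if i \in I then (#|I|%:R)^-1 else 0); split.
- by move=> i; case: ifP => // _; rewrite invr_ge0.
- by rewrite -big_mkcond sumr_const -[_^-1 *+ _]mulr_natr mulVf.
- rewrite /barycenter big_mkcond; apply: eq_bigr => i _.
  by case: ifP => // _; rewrite scale0r.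
Qed.

(** At the barycenter of its vertices, a face with normal [c] only meets the
    inequalities that are tight on the whole face; so [c] is a nonnegative
    combination of their normals, and a vertex on which all of them are tight
    lies in the face. For the empty face this says that no vertex is on all
    facets, since the ray through its opposite would lie in the polytope. *)
Lemma face_incidence_closed V A F : conv_cols V = halfspaces A -> (0 < m)%N ->
  face (conv_cols V) F -> incidence_closed (tight V A) (face_vertices V F).
Proof.
move=> VA m0 [c [b [cb FE]]]; set I := face_vertices V F => i iI.
have IE k : k \in I <-> dot c (col k V) = b.
  split=> [/face_verticesP|kb]; first by rewrite FE => -[].
  by apply/face_verticesP; rewrite FE; split=> //; exact: conv_cols_col.
have [I0|I0] := eqVneq I finset.set0.
  have tij j : dot (col j A) (col i V) = 1.
    by apply/eqP; apply: iI => k; rewrite I0 inE.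
  have v0 : - col i V = 0.
    by apply: (recession_eq0 VA) => j; rewrite dotNr tij oppr_le0.
  have := tij (Ordinal m0); rewrite -[col i V]opprK v0 oppr0 dot0r => /eqP.
  by rewrite eq_sym oner_eq0.
have Ix : dot c (barycenter V I) = b by apply: dot_barycenter_eq => // k /IE.
have [||l [l0 lt cl]] := @supporting_cone A (barycenter V I) c.
- by rewrite -VA; exact: conv_cols_barycenter.
- by move=> y Ay; rewrite Ix; apply: cb; rewrite VA.
have tl j : l j != 0 -> forall k, k \in I -> tight V A k j.
  move=> lj k kI; apply: contraNT lj => kj; apply/eqP; apply: lt.
  rewrite lt_eqF//; apply: dot_barycenter_lt => [k' _|]; first exact: dot_cols_le.
  by exists k => //; rewrite lt_neqAle kj dot_cols_le.
apply/IE; rewrite -Ix cl !dot_combl; apply: eq_bigr => j _.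
have [->|lj] := eqVneq (l j) 0; first by rewrite !mul0r.
congr (_ * _); rewrite (dot_barycenter_eq (b := 1))//.
  by apply/eqP; apply: iI; exact: tl.
by move=> k kI; apply/eqP; exact: tl.
Qed.

(** The sum of the normals of all facets that contain [I] is maximal exactly on
    the intersection of these facets. *)
Lemma incidence_closed_face V A I : conv_cols V = halfspaces A ->
  incidence_closed (tight V A) I ->
  exists2 F, face (conv_cols V) F & face_vertices V F = I.
Proof.
move=> VA cI; pose J := [set j | [forall k in I, tight V A k j]]%SET.
pose c := \sum_(j in J) col j A.
have cE x : dot c x = \sum_(j in J) dot (col j A) x.
  by rewrite dotC /c /dot mulmx_sumr summxE; apply: eq_bigr => j _; rewrite -[LHS]/(dot _ _) dotC.
have cle x : conv_cols V x -> dot c x <= #|J|%:R.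
  rewrite VA cE => /halfspacesE Ax; rewrite -sumr_const.
  by apply: ler_sum => j _.
exists [set x | conv_cols V x /\ dot c x = #|J|%:R]; first by exists c, #|J|%:R.
apply/setP => i; apply/idP/idP.
  move=> /face_verticesP[Ki]; rewrite cE -sumr_const => E.
  apply: cI => j jI; have jJ : j \in J.
    by rewrite inE; apply/forall_inP => k kI; exact: jI.
  apply/negPn/negP => nij; move/eqP: E; rewrite lt_eqF//.
  rewrite (bigD1 j)//= [ltRHS](bigD1 j)//= ltr_leD//.
    by rewrite lt_neqAle nij dot_cols_le.
  by apply: ler_sum => k _; exact: dot_cols_le.
move=> iI; apply/face_verticesP; split; first exact: conv_cols_col.
rewrite cE -sumr_const; apply: eq_bigr => j; rewrite inE => /forall_inP/(_ _ iI).
by move/eqP.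
Qed.

Lemma facet_of_face V A j : conv_cols V = halfspaces A ->
  face (conv_cols V) (facet_of V A j).
Proof.
move=> VA; exists (col j A), 1; split; first by move=> x; rewrite VA => /halfspacesE/(_ j).
apply/seteqP; split=> x [Kx ax]; split=> //; first by rewrite -[LHS]/(dot _ _) -halfspaces_row.
by rewrite halfspaces_row; exact: ax.
Qed.

Lemma facet_of_vertices V A j i :
  i \in face_vertices V (facet_of V A j) <-> tight V A i j.
Proof.
split=> [/face_verticesP[_]|/eqP ij]; first by rewrite halfspaces_row => /eqP.
by apply/face_verticesP; split; [exact: conv_cols_col|rewrite halfspaces_row].
Qed.

(** * Dimensions of facets *)

(** Spanning is witnessed by a right inverse supported on [I], since it is the
    invertibility of [V *m G] that survives a perturbation of [V]. *)
Definition spanning_by V (I : pred 'I_n) : Prop :=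
  exists2 G : 'M[R]_(n, d), forall i k, ~~ I i -> G i k = 0 & V *m G = 1%:M.

Lemma spanning_byP V (I : pred 'I_n) :
  (forall c, (forall i, I i -> dot c (col i V) = 0) -> c = 0) ->
  spanning_by V I.
Proof.
move=> I0; pose D : 'M[R]_n := diag_mx (\row_i (I i)%:R).
have /row_freeP[C VC] : row_free (V *m D).
  apply: inj_row_free => u uVD; apply: trmx_inj; rewrite trmx0; apply: I0 => i Ii.
  move/rowP: uVD => /(_ i); rewrite mulmxA mul_mx_diag !mxE Ii mulr1 => <-.
  by rewrite dotE; apply: eq_bigr => k _; rewrite !mxE.
exists (D *m C); last by rewrite mulmxA.
by move=> i k /negbTE Ii; rewrite mul_diag_mx !mxE Ii mul0r.
Qed.

Lemma mulmx_cols k (V : 'M[R]_(d, k)) (x : 'cV[R]_k) :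
  V *m x = \sum_i x i 0 *: col i V.
Proof.
apply/colP => r; rewrite mxE summxE; apply: eq_bigr => i _.
by rewrite !mxE mulrC.
Qed.

Lemma affine_hull_sub F c b : (forall x, F x -> dot c x = b) ->
  forall x, affine_hull F x -> dot c x = b.
Proof.
move=> Fb x [k [p [l [pF l1 ->]]]]; rewrite dot_combr.
by under eq_bigr => i _ do rewrite Fb//; rewrite -mulr_suml l1 mul1r.
Qed.

Definition dot_kernel (a : 'cV[R]_d) : {vspace 'cV[R]_d} :=
  lker (linfun (mulmx a^T : 'cV[R]_d -> 'cV[R]_1)).

Lemma dot_kernelP a x : x \in dot_kernel a <-> dot a x = 0.
Proof.
rewrite memv_ker lfunE /= /dot; split=> [/eqP->|ax]; first by rewrite mxE.
by apply/eqP/colP => i; rewrite !ord1 ax mxE.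
Qed.

Lemma dim_dot_kernel a x : dot a x != 0 -> (\dim (dot_kernel a)).+1 = d.
Proof.
move=> ax; set f := linfun (mulmx a^T : 'cV[R]_d -> 'cV[R]_1).
have := limg_ker_dim f fullv; rewrite capfv dimvf /dim /= muln1 => E; rewrite -[RHS]E.
suff -> : (f @: fullv)%VS = fullv by rewrite dimvf /dim /= muln1 addn1.
apply/vspaceP => y; rewrite memvf; apply/memv_imgP.
exists ((y 0 0 / dot a x) *: x); first exact: memvf.
apply/colP => i; rewrite lfunE /= !ord1 -[RHS]/(dot a _) dotZr divfK//.
Qed.

Lemma has_dim_conv_cols V A : conv_cols V = halfspaces A ->
  has_dim (conv_cols V) d%:Z.
Proof.
move=> VA; right; exists 0, fullv; split; first exact: conv_cols0 VA.
  apply/seteqP; split=> x; first by exists x; rewrite ?add0r//=; exact: memvf.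
  move=> _; have lt1 : forall j : 'I_m, (0 : R) < 1 by [].
  have [e e0 eP] := small_step (fun j => dot (col j A) x) lt1.
  have ex : conv_cols V (e *: x).
    rewrite VA; apply/halfspacesE => j; apply/ltW; rewrite dotZr -[ltLHS]add0r.
    by apply: eP; rewrite e0 lexx.
  exists 2%N, (fun i => if i == 0 then e *: x else 0),
    (fun i => if i == 0 then e^-1 else 1 - e^-1); split.
  - by move=> i; case: ifP => // _; exact: conv_cols0 VA.
  - by rewrite big_ord_recl big_ord1 /= subrKC.
  - rewrite big_ord_recl big_ord1 /= scaler0 addr0 scalerA mulVf ?scale1r//.
    by rewrite gt_eqF.
by rewrite dimvf /dim /= muln1.
Qed.

Lemma facet_of_dim0 V A j : d = 0%N -> facet_of V A j = set0.
Proof.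
move=> d0; apply/seteqP; split=> x // [_]; rewrite halfspaces_row dotE.
rewrite big1 => [/eqP|i _]; first by rewrite eq_sym oner_eq0.
by have := ltn_ord i; rewrite {2}d0.
Qed.

Lemma codim1_lt0 (k : nat) : k%:Z - 1 = -1 -> k = 0%N.
Proof. by case: k => // k /eqP; rewrite subr_eq addNr. Qed.

(** The affine hull of a facet is a hyperplane that misses the origin; so the
    vertices of the facet span the whole space linearly. *)
Lemma facet_spanning V A j : (0 < d)%N -> conv_cols V = halfspaces A ->
  has_dim (facet_of V A j) (d%:Z - 1) -> spanning_by V (tight V A ^~ j).
Proof.
move=> d0 VA [[_ /codim1_lt0 d0']|[x [U [Fx aff dU]]]].
  by move: d0; rewrite d0'.
apply: spanning_byP => c cj.
have Fc y : facet_of V A j y -> dot c y = 0.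
  rewrite (face_hull (facet_of_face j VA)) => /hullP[l [_ lF _ ->]].
  rewrite dot_combr big1// => i _; have [it|/lF->] :=
    boolP (i \in face_vertices V (facet_of V A j)); last by rewrite mul0r.
  by rewrite cj ?mulr0//; apply/facet_of_vertices.
have Fa y : facet_of V A j y -> dot (col j A) y = 1.
  by move=> [_]; rewrite halfspaces_row.
have affU u : u \in U -> affine_hull (facet_of V A j) (x + u).
  by move=> uU; rewrite aff; exists u.
have Uc : (U <= dot_kernel c)%VS.
  apply/subvP => u /affU /(affine_hull_sub Fc); rewrite dotDr Fc// add0r => cu.
  exact/dot_kernelP.
have xU : x \notin U.
  apply/negP => /affU /(affine_hull_sub Fa); rewrite dotDr Fa// => /eqP.
  by rewrite -subr_eq0 addrK oner_eq0.
have Ux0 : (U :&: <[x]> = 0)%VS.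
  apply/eqP; rewrite -subv0; apply/subvP => y; rewrite memv_cap memv0.
  move=> /andP[yU /vlineP[k yk]]; rewrite yk in yU *.
  have [->|k0] := eqVneq k 0; first by rewrite scale0r.
  by move: xU; rewrite -[x](scalerK k0) memvZ.
have full : (U + <[x]>)%VS = fullv.
  apply/eqP; rewrite eqEdim subvf dimvf /dim /= muln1 dimv_disjoint_sum//.
  have x0 : x != 0 by apply: contraNneq xU => ->; rewrite mem0v.
  have : (d%:Z = (\dim U + 1)%:Z) by rewrite PoszD -dU subrK.
  by move=> [dE]; rewrite dim_vline x0 -dE.
apply: dot_eq0 => y; have := memvf y; rewrite -full.
move=> /memv_addP[u uU [_ /vlineP[k ->] ->]].
rewrite dotDr dotZr (Fc x)// mulr0 addr0; apply/dot_kernelP.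
by move/subvP: Uc; apply.
Qed.

Lemma spanning_facet_dim V A j : conv_cols V = halfspaces A ->
  ((0 < d)%N -> spanning_by V (tight V A ^~ j)) ->
  has_dim (facet_of V A j) (d%:Z - 1).
Proof.
move=> VA; have [d0 _|d0 /(_ isT)[G Gj VG]] := posnP d.
  by left; rewrite facet_of_dim0// d0.
have [i0 ij0] : exists i, tight V A i j.
  apply: contrapT => nt; move/matrixP: VG => /(_ (Ordinal d0) (Ordinal d0)).
  rewrite !mxE eqxx big1 => [/eqP|i _]; first by rewrite eq_sym oner_eq0.
  by rewrite Gj ?mulr0//; apply/negP => ti; apply: nt; exists i.
have Fi i : tight V A i j -> facet_of V A j (col i V).
  by move/facet_of_vertices/face_verticesP.
have Fa y : facet_of V A j y -> dot (col j A) y = 1.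
  by move=> [_]; rewrite halfspaces_row.
right; exists (col i0 V), (dot_kernel (col j A)); split; first exact: Fi.
  apply/seteqP; split=> y.
    move=> /(affine_hull_sub Fa) ay; exists (y - col i0 V); last by rewrite subrKC.
    by apply/dot_kernelP; rewrite dotDr dotNr ay (Fa _ (Fi _ ij0)) subrr.
  move=> [u /dot_kernelP au yE].
  have ay : dot (col j A) y = 1 by rewrite -yE dotDr au (Fa _ (Fi _ ij0)) addr0.
  have yG : y = \sum_i (G *m y) i 0 *: col i V by rewrite -mulmx_cols mulmxA VG mul1mx.
  have G0 i : ~~ tight V A i j -> (G *m y) i 0 = 0.
    by move=> ti; rewrite mxE big1// => k _; rewrite Gj ?mul0r.
  exists n, (fun i => if tight V A i j then col i V else col i0 V), (fun i => (G *m y) i 0).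
  split.
  - by move=> i; case: ifP => [/Fi//|_]; exact: Fi.
  - rewrite -[RHS]ay [in RHS]yG dot_combr; apply: eq_bigr => i _.
    by have [/eqP->|/G0->] := boolP (tight V A i j); rewrite ?mulr1 ?mul0r.
  - rewrite [LHS]yG; apply: eq_bigr => i _; case: ifPn => // /G0->.
    by rewrite !scale0r.
have a0 : dot (col j A) (col i0 V) != 0 by rewrite (Fa _ (Fi _ ij0)) oner_eq0.
transitivity ((\dim (dot_kernel (col j A))).+1%:Z - 1).
  by rewrite (dim_dot_kernel a0).
by rewrite -addn1 PoszD addrK.
Qed.

(** A face of codimension 1 is contained in some facet given by an inequality,
    since otherwise incidence-closedness would make it the whole polytope; the
    two then have the same affine hull. *)
Lemma facet_is_facet_of V A F : conv_cols V = halfspaces A -> (0 < m)%N ->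
  facets d (conv_cols V) F -> exists j, F = facet_of V A j.
Proof.
move=> VA m0 [fF [[F0 /codim1_lt0 d0]|[x [U [Fx aff dU]]]]].
  by exists (Ordinal m0); rewrite facet_of_dim0.
have affU u : u \in U -> affine_hull F (x + u) by move=> uU; rewrite aff; exists u.
have dE : d = (\dim U).+1.
  have : d%:Z = (\dim U + 1)%:Z by rewrite PoszD -dU subrK.
  by rewrite addn1 => -[].
have [j jF] : exists j, forall k, k \in face_vertices V F -> tight V A k j.
  apply: contrapT => nj.
  have allF i : i \in face_vertices V F.
    apply: (face_incidence_closed VA m0 fF) => j jF.
    by exfalso; apply: nj; exists j.
  have FK : F = conv_cols V.
    apply: face_vertices_inj fF (face_conv_cols V) _; apply/setP => i.
    by rewrite allF; apply/esym/face_verticesP; exact: conv_cols_col.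
  suff : (\dim (fullv : {vspace 'cV[R]_d}) <= \dim U)%N.
    by rewrite dimvf /dim /= muln1 {1}dE ltnn.
  apply: dimvS; apply/subvP => y _.
  have [[_ d0]|[x' [U' [_ aff' dU']]]] := has_dim_conv_cols VA; first by [].
  have U'full : U' = fullv.
    apply/eqP; rewrite eqEdim subvf dimvf /dim /= muln1.
    by case: dU' => {1}->.
  have : affine_hull (conv_cols V) (x + y).
    by rewrite aff'; exists (x + y - x'); rewrite ?subrKC// U'full; exact: memvf.
  by rewrite -FK aff => -[u uU /addrI<-].
exists j; have fj := facet_of_face j VA.
have FFj : F `<=` facet_of V A j.
  apply/(sub_face fF fj)/fintype.subsetP => k /jF.
  by move/facet_of_vertices.
have Fa y : F y -> dot (col j A) y = 1.
  by move=> /FFj[_]; rewrite halfspaces_row.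
apply/seteqP; split=> // y [Ky]; rewrite halfspaces_row => ay.
have [c [b [cb FE]]] := fF.
have Fb z : F z -> dot c z = b by rewrite FE => -[].
rewrite FE; split=> //; apply: (affine_hull_sub Fb).
rewrite aff; exists (y - x); last by rewrite subrKC.
suff <- : dot_kernel (col j A) = U.
  by apply/dot_kernelP; rewrite dotDr dotNr ay Fa// subrr.
apply/esym/eqP; rewrite eqEdim; apply/andP; split.
  apply/subvP => u /affU/(affine_hull_sub Fa); rewrite dotDr Fa//.
  by move=> /(canRL (addKr _)); rewrite addNr => au; apply/dot_kernelP.
have a0 : dot (col j A) x != 0 by rewrite Fa// oner_eq0.
by rewrite -ltnS (dim_dot_kernel a0) -dE.
Qed.

End Faces.

(** * Realizations near a given one *)

Section Nearby.
Context {R : realType} {d n m : nat}.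
Implicit Types (V : 'M[R]_(d, n)) (A : 'M[R]_(d, m)) (I : {set 'I_n}).

Lemma near_forall (T : topologicalType) (x : T) (J : finType) (Q : J -> T -> Prop) :
  (forall j, \forall y \near x, Q j y) -> \forall y \near x, forall j, Q j y.
Proof. by move=> Qx; apply: (@filter_forall _ _ _ _ (nbhs_filter x)). Qed.

Lemma near_all (T : topologicalType) (x : T) (Q : T -> Prop) :
  (forall y, Q y) -> \forall y \near x, Q y.
Proof. by move=> Qx; apply: nearW. Qed.

Lemma near_rational_lt p q (U : set 'M[R]_(p, q)) (f : 'M[R]_(p, q) -> R) X0 a :
  open U -> U X0 -> rational_on U f -> f X0 < a -> \forall X \near X0, f X < a.
Proof. by move=> oU UX0 rf; exact: cvgr_lt (rational_continuous oU rf UX0) _. Qed.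

Lemma near_rational_gt p q (U : set 'M[R]_(p, q)) (f : 'M[R]_(p, q) -> R) X0 a :
  open U -> U X0 -> rational_on U f -> a < f X0 -> \forall X \near X0, a < f X.
Proof. by move=> oU UX0 rf; exact: cvgr_gt (rational_continuous oU rf UX0) _. Qed.

Lemma rational_id p q (U : set 'M[R]_(p, q)) : rational_map U id.
Proof. by move=> i j; exact: RationalCoord. Qed.

Lemma rational_mulmx_cst p q r (U : set 'M[R]_(p, q)) (G : 'M[R]_(q, r)) :
  rational_map U (fun X => X *m G).
Proof. by apply: rational_mul; [exact: rational_id|exact: rational_cst]. Qed.

Lemma near_unitmx V0 (G : 'M[R]_(n, d)) : V0 *m G \in unitmx ->
  \forall V \near V0, V *m G \in unitmx.
Proof.
move=> VG; apply: open_nbhs_nbhs; split=> //.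
by apply: open_unitmx; exact: rational_mulmx_cst.
Qed.

Lemma near_spanning_by V0 (I : pred 'I_n) : spanning_by V0 I ->
  \forall V \near V0, spanning_by V I.
Proof.
move=> [G GI VG]; have uG : V0 *m G \in unitmx by rewrite VG unitmx1.
apply: filterS (near_unitmx uG) => V uV.
exists (G *m invmx (V *m G)); last by rewrite mulmxA mulmxV.
by move=> i k Ii; rewrite mxE big1// => l _; rewrite GI ?mul0r.
Qed.

(** A right inverse of [V0] lets the weights of a combination be corrected
    continuously, so as to keep representing the moving point [V *m b]. *)
Lemma near_positive_comb V0 (b w0 : 'cV[R]_n) :
  spanning_by V0 predT -> V0 *m w0 = V0 *m b ->
  (forall i, 0 < w0 i 0) -> \sum_i w0 i 0 < 1 ->
  \forall V \near V0, exists w : 'cV[R]_n,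
    [/\ forall i, 0 < w i 0, \sum_i w i 0 < 1 & V *m w = V *m b].
Proof.
move=> [G _ VG] Vwb w0_gt0 w0_lt1.
have uG : V0 *m G \in unitmx by rewrite VG unitmx1.
pose U := [set V | V *m G \in unitmx].
have oU : open U by apply: open_unitmx; exact: rational_mulmx_cst.
pose w V := w0 + G *m (invmx (V *m G) *m (V *m (b - w0))).
have rw : rational_map U w.
  apply: rational_add; first exact: rational_cst.
  apply: rational_mul; first exact: rational_cst.
  apply: rational_mul; last exact: rational_mulmx_cst.
  by apply: rational_inv => //; exact: rational_mulmx_cst.
have w0E : w V0 = w0 by rewrite /w mulmxBr Vwb subrr !mulmx0 addr0.
have w_gt0 : \forall V \near V0, forall i, 0 < w V i 0.
  apply: near_forall => i; apply: (near_rational_gt oU uG (rw i 0)).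
  by rewrite w0E.
have w_lt1 : \forall V \near V0, \sum_i w V i 0 < 1.
  apply: (near_rational_lt oU uG (rational_sum _ _ (fun i => rw i 0))).
  by rewrite w0E.
apply: filterS3 (near_unitmx uG) w_gt0 w_lt1 => V uV wV_gt0 wV_lt1.
exists (w V); split=> //.
by rewrite /w mulmxDr mulmxA mulmxA mulmxV// mul1mx -mulmxDr subrKC.
Qed.

Lemma mulmx_barycenter V I :
  V *m (\col_i if i \in I then (#|I|%:R)^-1 else 0) = barycenter V I.
Proof.
rewrite mulmx_cols /barycenter [RHS]big_mkcond; apply: eq_bigr => i _.
by rewrite mxE; case: ifP => // _; rewrite scale0r.
Qed.

(** The barycenter of a nonempty set [I] of vertices is an interior point exactly
    when [I] is not contained in a facet. It remains a combination with positive weights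
    of total less than 1 for nearby vertices, and this prevents a valid
    inequality from being active on all of [I]. *)
Lemma near_active_sub_facet V0 A0 : conv_cols V0 = halfspaces A0 ->
  \forall V \near V0, forall c, (forall i, dot c (col i V) <= 1) ->
    active c V != finset.set0 ->
    exists j, forall i, i \in active c V -> tight V0 A0 i j.
Proof.
move=> VA0.
have sp0 : spanning_by V0 predT.
  by apply: spanning_byP => c c0; apply: (dot_vertices_eq0 VA0) => i; exact: c0.
suff : \forall V \near V0, forall I, I != finset.set0 ->
    ~ (exists j, forall i, i \in I -> tight V0 A0 i j) ->
    exists w : 'cV[R]_n, [/\ forall i, 0 < w i 0, \sum_i w i 0 < 1 &
      V *m w = barycenter V I].
  apply: filterS => V nearV c cV act0; apply: contrapT => nj.
  have [w [w_gt0 w_lt1 wV]] := nearV _ act0 nj.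
  have : dot c (barycenter V (active c V)) = 1.
    by apply: dot_barycenter_eq => // i; rewrite inE => /eqP.
  rewrite -wV mulmx_cols dot_combr => E; move: w_lt1.
  rewrite ltNge -E => /negP; apply; apply: ler_sum => i _.
  by rewrite -[leRHS]mulr1 ler_wpM2l// ltW.
apply: near_forall => I; have [->|I0] := eqVneq I finset.set0.
  by apply: near_all => V.
have [tj|nj] := pselect (exists j, forall i, i \in I -> tight V0 A0 i j).
  by apply: near_all => V _ /(_ tj).
have [j|w [w_gt0 w_lt1 wE]] := interior_positive_comb VA0 (x := barycenter V0 I).
  apply: dot_barycenter_lt => [i _|]; first exact: dot_cols_le.
  apply: contrapT => nlt; apply: nj; exists j => i iI; apply/negPn/negP => nt.
  by apply: nlt; exists i => //; rewrite lt_neqAle nt dot_cols_le.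
pose b : 'cV[R]_n := \col_i if i \in I then (#|I|%:R)^-1 else 0.
have := @near_positive_comb V0 b (\col_i w i) sp0.
rewrite mulmx_barycenter {1}wE mulmx_cols => near_w.
apply: filterS (near_w _ _ _) => [V h _ _||i|].
- by rewrite -mulmx_barycenter.
- by apply: eq_bigr => i _; rewrite mxE.
- by rewrite mxE.
- by under eq_bigr => i _ do rewrite mxE.
Qed.

Lemma near_positive_relation V0 A0 : conv_cols V0 = halfspaces A0 ->
  \forall V \near V0, exists2 w : 'I_n -> R, forall i, 0 < w i &
    \sum_i w i *: col i V = 0.
Proof.
move=> VA0; have sp0 : spanning_by V0 predT.
  by apply: spanning_byP => c c0; apply: (dot_vertices_eq0 VA0) => i; exact: c0.
have [j|w [w_gt0 w_lt1 wE]] := interior_positive_comb VA0 (x := 0).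
  by rewrite dot0r.
have := @near_positive_comb V0 0 (\col_i w i) sp0.
rewrite mulmx0 [in V0 *m _]mulmx_cols => near_w.
apply: filterS (near_w _ _ _) => [V [w' [w'0 _ w'V]]||i|].
- by exists (fun i => w' i 0) => //; rewrite -mulmx_cols w'V mulmx0.
- by rewrite [RHS]wE; apply: eq_bigr => i _; rewrite mxE.
- by rewrite mxE.
- by under eq_bigr => i _ do rewrite mxE.
Qed.

Lemma rational_dot_cols i j (U : set 'M[R]_(d, n + m)) :
  rational_on U (fun X => dot (col j (rsubmx X)) (col i (lsubmx X))).
Proof.
apply: (@RationalExt _ _ _ _
  (fun X => \sum_k X k (rshift n j) * X k (lshift m i))).
  by apply: rational_sum => k; apply: RationalMul; exact: RationalCoord.
by move=> X _; rewrite dotE; apply: eq_bigr => k _; rewrite !mxE.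
Qed.

(** Strictness off the incidences, spanning of the facets, and positive
    dependence of the vertices are open conditions; together with the equations
    they force the two descriptions to agree. *)
Lemma near_realization (X0 : 'M[R]_(d, n + m)) :
  conv_cols (lsubmx X0) = halfspaces (rsubmx X0) ->
  (forall j, (0 < d)%N ->
     spanning_by (lsubmx X0) (tight (lsubmx X0) (rsubmx X0) ^~ j)) ->
  \forall X \near X0,
    (forall i j, tight (lsubmx X0) (rsubmx X0) i j ->
                 tight (lsubmx X) (rsubmx X) i j) ->
    [/\ conv_cols (lsubmx X) = halfspaces (rsubmx X),
        tight (lsubmx X) (rsubmx X) = tight (lsubmx X0) (rsubmx X0) &
        forall j, (0 < d)%N ->
          spanning_by (lsubmx X) (tight (lsubmx X) (rsubmx X) ^~ j)].
Proof.
set V0 := lsubmx X0; set A0 := rsubmx X0 => VA0 sp0.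
have n_gt0 : (0 < n)%N.
  have /conv_colsP[l [_ l1 _]] := conv_cols0 VA0.
  rewrite lt0n; apply/eqP => n0; move: l1; rewrite big1 => [/eqP|i _].
    by rewrite eq_sym oner_eq0.
  by have := ltn_ord i; rewrite {2}n0.
have lift_near (Q : set 'M[R]_(d, n)) : (\forall V \near V0, Q V) ->
    \forall X \near X0, Q (lsubmx X) by move=> /continuous_lsubmx.
have spT : spanning_by V0 predT.
  by apply: spanning_byP => c c0; apply: (dot_vertices_eq0 VA0) => i; exact: c0.
have near_lt : \forall X \near X0, forall i j, ~~ tight V0 A0 i j ->
    dot (col j (rsubmx X)) (col i (lsubmx X)) < 1.
  apply: near_forall => i; apply: near_forall => j.
  have [t|nt] := boolP (tight V0 A0 i j); first exact: near_all.
  have := near_rational_lt (f := fun X => dot (col j (rsubmx X)) (col i (lsubmx X)))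
    openT I (rational_dot_cols i j setT) => /(_ X0 1).
  rewrite lt_neqAle nt dot_cols_le// => /(_ isT).
  by apply: filterS => X.
have near_sp : \forall X \near X0, forall j, (0 < d)%N ->
    spanning_by (lsubmx X) (tight V0 A0 ^~ j).
  apply: near_forall => j; have [d0|d0] := boolP (0 < d)%N; last first.
    exact: near_all.
  have := lift_near _ (near_spanning_by (sp0 j d0)).
  by apply: filterS => X.
have near_spT := lift_near _ (near_spanning_by spT).
have near_pos := lift_near _ (near_positive_relation VA0).
have near_act := lift_near _ (near_active_sub_facet VA0).
near=> X.
have ltX : forall i j, ~~ tight V0 A0 i j ->
    dot (col j (rsubmx X)) (col i (lsubmx X)) < 1 by near: X.
have spX : forall j, (0 < d)%N -> spanning_by (lsubmx X) (tight V0 A0 ^~ j).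
  by near: X.
have [G _ XG] : spanning_by (lsubmx X) predT by near: X.
have [w w0 wX] : exists2 w : 'I_n -> R, forall i, 0 < w i &
    \sum_i w i *: col i (lsubmx X) = 0 by near: X.
have actX : forall c, (forall i, dot c (col i (lsubmx X)) <= 1) ->
    active c (lsubmx X) != finset.set0 ->
    exists j, forall i, i \in active c (lsubmx X) -> tight V0 A0 i j by near: X.
move=> eqX; have tE : tight (lsubmx X) (rsubmx X) = tight V0 A0.
  apply/funext => i; apply/funext => j; apply/idP/idP; last exact: eqX.
  by apply: contraTT => /ltX lt; rewrite /tight lt_eqF.
split=> //; last by rewrite tE.
apply/seteqP; split.
  apply: hull_sub_halfspaces => i j.
  by have [/eqX/eqP->//|/ltX/ltW] := boolP (tight V0 A0 i j).
apply: (halfspaces_sub_hull n_gt0 w0 wX) => [c cX|c cX act0].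
  apply: dot_eq0 => y; rewrite -[y]mul1mx -XG -mulmxA mulmx_cols dot_combr.
  by rewrite big1// => i _; rewrite cX mulr0.
have [j jP] := actX c cX act0; exists j => i /jP/eqX.
by move/eqP.
Unshelve. all: by end_near. Qed.

End Nearby.

(** * Transporting the face lattice *)

Section Transfer.
Context {R : realType} {d n m : nat}.
Implicit Types (V : 'M[R]_(d, n)) (A : 'M[R]_(d, m)).
Local Notation hull V I := (convex_hull [set x | exists2 i, i \in I & x = col i V]).

(** In dimension 0 the empty face counts as a facet; in positive dimension a
    polyhedron without inequalities is unbounded. *)
Lemma labeled_polytope_facets_gt0 V A : conv_cols V = halfspaces A ->
  labeled_polytope d (labeled_conv V A) -> (0 < m)%N.
Proof.
move=> VA [_ _ _ [_ _ surj]]; rewrite lt0n; apply/eqP => m0.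
have noj (j : 'I_m) : False by have := ltn_ord j; rewrite {2}m0.
have [d0|d0] := posnP d.
  have /surj[j] : facets d (conv_cols V) set0; last by case: (noj j).
  split; last by left; rewrite d0.
  exists 0, 1; split=> [x _|]; first by rewrite -[leLHS]/(dot 0 x) dot0l.
  apply/seteqP; split=> // x [_ /eqP]; rewrite -[X in X == _]/(dot 0 x) dot0l.
  by rewrite eq_sym oner_eq0.
have /colP/(_ (Ordinal d0)) : const_mx 1 = 0 :> 'cV[R]_d.
  by apply: (recession_eq0 VA) => j; case: (noj j).
by rewrite !mxE => /eqP; rewrite oner_eq0.
Qed.

Section Isomorphism.
Context (V0 V : 'M[R]_(d, n)) (A0 A : 'M[R]_(d, m)) (m_gt0 : (0 < m)%N).
Context (VA0 : conv_cols V0 = halfspaces A0) (VA : conv_cols V = halfspaces A).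
Context (tVA : tight V A = tight V0 A0).

Definition face_transfer (F : set 'cV[R]_d) : set 'cV[R]_d :=
  hull V (face_vertices V0 F).

(** The vertex sets of faces are the incidence-closed ones for both polytopes. *)
Lemma face_transferP F : face (conv_cols V0) F ->
  face (conv_cols V) (face_transfer F) /\
  face_vertices V (face_transfer F) = face_vertices V0 F.
Proof.
move=> fF; have := face_incidence_closed VA0 m_gt0 fF.
rewrite -tVA => /(incidence_closed_face VA)[G fG VG].
suff -> : face_transfer F = G by split.
by rewrite /face_transfer -VG -face_hull.
Qed.

Lemma face_transfer_isomorphism :
  set_inj setT (fun i => col i V0) ->
  (forall i, face (conv_cols V0) [set col i V0]) ->
  labeled_face_isomorphism (labeled_conv V0 A0) (labeled_conv V A) face_transfer.
Proof.
move=> V0_inj V0_face; split=> /=.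
- split.
  + by move=> F /face_transferP[].
  + move=> F G /set_mem fF /set_mem fG FG.
    have [_ vF] := face_transferP fF; have [_ vG] := face_transferP fG.
    by apply: face_vertices_inj fF fG _; rewrite -vF -vG FG.
  + move=> G fG; have := face_incidence_closed VA m_gt0 fG.
    rewrite tVA => /(incidence_closed_face VA0)[F fF VF]; exists F => //.
    have [fF' vF'] := face_transferP fF.
    by apply: face_vertices_inj fF' fG _; rewrite vF' VF.
- move=> F G fF fG.
  have [fF' vF'] := face_transferP fF; have [fG' vG'] := face_transferP fG.
  by rewrite (sub_face fF fG) (sub_face fF' fG') vF' vG'.
- move=> i; rewrite -[RHS]hull_set1 /face_transfer.
  have -> // : face_vertices V0 [set col i V0] = [set i]%SET.
  apply/setP => k; rewrite finset.in_set1; apply/idP/eqP => [/face_verticesP|->].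
    by move=> /= ki; apply: V0_inj; rewrite ?in_setT.
  exact/face_verticesP.
- move=> j; have f0 := facet_of_face j VA0; have f := facet_of_face j VA.
  have [f' v'] := face_transferP f0.
  apply: face_vertices_inj f' f _; rewrite v'; apply/setP => i.
  by apply/idP/idP => /facet_of_vertices; rewrite ?tVA => ?;
     apply/facet_of_vertices; rewrite ?tVA.
Qed.

Lemma transfer_labeled_polytope :
  labeled_polytope d (labeled_conv V0 A0) ->
  (forall j, (0 < d)%N -> spanning_by V (tight V A ^~ j)) ->
  labeled_polytope d (labeled_conv V A) /\
  exists phi, labeled_face_isomorphism (labeled_conv V0 A0) (labeled_conv V A) phi.
Proof.
move=> [_ _ [Vfun V0_inj _] [_ F0_inj _]] sp.
have V0_face i : face (conv_cols V0) [set col i V0] by exact: Vfun.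
have iso := face_transfer_isomorphism V0_inj V0_face.
split; last by exists face_transfer.
have [[phi_fun phi_inj _] _ phi_vtx phi_fct] := iso.
split.
- by exists (range (fun i => col i V)) => //; exact: finite_image.
- exact: has_dim_conv_cols VA.
- split=> /=.
  + by move=> i _; have := phi_fun _ (V0_face i); rewrite (phi_vtx i).
  + move=> i k _ _ ik; apply: V0_inj; rewrite ?in_setT//.
    have : [set col i V0] = [set col k V0].
      apply: phi_inj; rewrite ?inE//; try exact: V0_face.
      by rewrite (phi_vtx i) (phi_vtx k) /= ik.
    by move=> /seteqP[/(_ _ erefl)].
  + move=> v fv; have : [set v] v by [].
    rewrite {1}(face_hull fv) => /hullP[l [_ lI l1 _]].
    have [i iv] : exists i, i \in face_vertices V [set v].
      apply: contrapT => ni; move: l1; rewrite big1 => [/eqP|i _].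
        by rewrite eq_sym oner_eq0.
      by apply: lI; apply/negP => ?; apply: ni; exists i.
    by exists i => //; move/face_verticesP: iv.
- split=> /=.
  + move=> j _; split; first exact: facet_of_face.
    by apply: spanning_facet_dim => //; exact: sp.
  + move=> j k _ _ jk; apply: F0_inj; rewrite ?in_setT//.
    apply: phi_inj; rewrite ?inE; try exact: (facet_of_face _ VA0).
    by rewrite (phi_fct j) (phi_fct k).
  + move=> F /(facet_is_facet_of VA m_gt0)[j ->]; by exists j.
Qed.

End Isomorphism.
End Transfer.

Lemma labeled_face_isomorphism_comp (R : realType) (e1 e2 e3 n m : nat)
    (P : labeled_body R e1 n m) (Q : labeled_body R e2 n m)
    (S : labeled_body R e3 n m) phi psi :
  labeled_face_isomorphism P Q phi -> labeled_face_isomorphism Q S psi ->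
  labeled_face_isomorphism P S (psi \o phi).
Proof.
move=> [bphi ophi vphi fphi] [bpsi opsi vpsi fpsi]; split=> /=.
- exact: set_bij_comp bphi bpsi.
- move=> F G fF fG; have [hphi _ _] := bphi.
  by rewrite (ophi F G fF fG); apply: opsi; exact: hphi.
- by move=> i; rewrite vphi vpsi.
- by move=> j; rewrite fphi fpsi.
Qed.

(** * The realization space near one of its points *)

Section RealizationSpace.
Context {R : realType} {d e n m : nat} (P : labeled_body R e n m).
Context (hP : labeled_polytope d P).
Implicit Types X : 'M[R]_(d, n + m).

Lemma incident_tight X i j : centered_realization_space P X ->
  incident P i j = tight (lsubmx X) (rsubmx X) i j.
Proof.
move=> [_ [_ [phi [_ ophi vphi fphi]]]].
have [_ _ [Pvtx _ _] [Pfct _ _]] := hP.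
have fv : face (body P) [set vtx P i] by exact: Pvtx.
have [ff _] : facets d (body P) (fct P j) by exact: Pfct.
have E : fct P j (vtx P i) <-> facet_of (lsubmx X) (rsubmx X) j (col i (lsubmx X)).
  have := ophi _ _ fv ff; rewrite vphi fphi => -[h1 h2]; split=> h.
    by apply: h1 => // x ->.
  by apply: h2 => // x ->.
apply/asboolP/idP => [/E h|t]; first by apply/facet_of_vertices/face_verticesP.
by apply/E/face_verticesP/facet_of_vertices.
Qed.

Definition incidence_equations X :=
  forall i j, incident P i j -> tight (lsubmx X) (rsubmx X) i j.

Lemma near_realization_space X0 : centered_realization_space P X0 ->
  \forall X \near X0, centered_realization_space P X <-> incidence_equations X.
Proof.
move=> RX0; have [VA0 [lp0 [phi0 iso0]]] := RX0.
have m0 := labeled_polytope_facets_gt0 VA0 lp0.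
have sp0 j : (0 < d)%N ->
    spanning_by (lsubmx X0) (tight (lsubmx X0) (rsubmx X0) ^~ j).
  move=> d0; apply: facet_spanning => //.
  by have [_ _ _ [Ffun _ _]] := lp0; have [] := Ffun j I.
apply: filterS (near_realization VA0 sp0) => X nearX.
split=> [RX i j|eqX]; first by rewrite (incident_tight _ _ RX).
have [|VA tE sp] := nearX.
  by move=> i j; rewrite -(incident_tight _ _ RX0); exact: eqX.
have [lp [phi iso]] := transfer_labeled_polytope m0 VA0 VA tE lp0 sp.
by split=> //; split=> //; exists (phi \o phi0);
   exact: labeled_face_isomorphism_comp iso0 iso.
Qed.

End RealizationSpace.

(** * Degenerate orderings *)

Section IncidenceOrdering.
Context {R : realType} {d e n m : nat} (P : labeled_body R e n m).
Context (s : seq ('I_n + 'I_m)%type).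
Context (hs : degenerate_ordering d (incidence_graph P) s).
Local Notation later a := (later_neighbors (incidence_graph P) s a).

Definition later_columns (x : 'I_(n + m)) : seq 'I_(n + m) :=
  match fintype.split x with
  | inl i => [seq rshift n j | j <- enum 'I_m & inr j \in later (inl i)]
  | inr j => [seq lshift m i | i <- enum 'I_n & inl i \in later (inr j)]
  end.

Lemma later_columns_lshift i : later_columns (lshift m i) =
  [seq rshift n j | j <- enum 'I_m & inr j \in later (inl i)].
Proof. by rewrite /later_columns (unsplitK (inl i)). Qed.

Lemma later_columns_rshift j : later_columns (rshift n j) =
  [seq lshift m i | i <- enum 'I_n & inl i \in later (inr j)].
Proof. by rewrite /later_columns (unsplitK (inr j)). Qed.

Lemma ordering_uniq : uniq s.
Proof. by case: hs => /perm_uniq->; rewrite enum_uniq. Qed.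

Lemma mem_ordering a : a \in s.
Proof. by case: hs => /perm_mem->; rewrite mem_enum. Qed.

Lemma index_neq a b : a != b -> (index a s != index b s)%N.
Proof.
apply: contra_neq => /(congr1 (nth a s)).
by rewrite !nth_index ?mem_ordering.
Qed.

Lemma index_unsplit a : index (unsplit a) [seq unsplit b | b <- s] = index a s.
Proof. by rewrite index_map//; exact: can_inj (@unsplitK n m). Qed.

Lemma index_later_columns x y : y \in later_columns x ->
  (index x [seq unsplit b | b <- s] < index y [seq unsplit b | b <- s])%N.
Proof.
rewrite -(splitK x); case: (fintype.split x) => [i|j] /=.
  rewrite later_columns_lshift => /mapP[j].
  rewrite mem_filter inE => /andP[/andP[_ lt] _] ->.
  by rewrite (index_unsplit (inl i)) (index_unsplit (inr j)).
rewrite later_columns_rshift => /mapP[i].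
rewrite mem_filter inE => /andP[/andP[_ lt] _] ->.
by rewrite (index_unsplit (inl i)) (index_unsplit (inr j)).
Qed.

Lemma later_columns_equations (X : 'M[R]_(d, n + m)) :
  (forall x y, y \in later_columns x -> \sum_k X k x * X k y = 1) <->
  incidence_equations P X.
Proof.
have dotE' i j : dot (col j (rsubmx X)) (col i (lsubmx X)) =
    \sum_k X k (lshift m i) * X k (rshift n j).
  by rewrite dotE; apply: eq_bigr => k _; rewrite !mxE mulrC.
split=> [eqX i j ij|eqX x y].
  apply/eqP; rewrite dotE'.
  have : (index (inl i : 'I_n + 'I_m) s != index (inr j : 'I_n + 'I_m) s)%N.
    exact: index_neq.
  rewrite neq_ltn => /orP[lt|lt].
    apply: eqX; rewrite later_columns_lshift map_f// mem_filter mem_enum.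
    by rewrite inE /= ij lt.
  under eq_bigr => k _ do rewrite mulrC.
  apply: eqX; rewrite later_columns_rshift map_f// mem_filter mem_enum.
  by rewrite inE /= ij lt.
rewrite -(splitK x); case: (fintype.split x) => [i|j] /=.
  rewrite later_columns_lshift => /mapP[j].
  rewrite mem_filter inE => /andP[/andP[/= ij _] _] ->.
  by rewrite -dotE'; apply/eqP; exact: eqX.
rewrite later_columns_rshift => /mapP[i].
rewrite mem_filter inE => /andP[/andP[/= ij _] _] ->.
under eq_bigr => k _ do rewrite mulrC.
by rewrite -dotE'; apply/eqP; exact: eqX.
Qed.

Lemma size_later_columns_le x : (size (later_columns x) <= d)%N.
Proof.
have [_ /(_ (fintype.split x))] := hs; apply: leq_trans.
rewrite cardE; rewrite -(size_map fintype.split); apply: uniq_leq_size.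
  rewrite map_inj_uniq; last exact: can_inj (@splitK n m).
  rewrite -(splitK x); case: (fintype.split x) => [i|j] /=.
    rewrite later_columns_lshift map_inj_uniq; first exact/filter_uniq/enum_uniq.
    exact: rshift_inj.
  rewrite later_columns_rshift map_inj_uniq; first exact/filter_uniq/enum_uniq.
  exact: lshift_inj.
move=> a /mapP[y + ->]; rewrite mem_enum -{1}(splitK x).
case: (fintype.split x) => [i|j] /=.
  rewrite later_columns_lshift => /mapP[j + ->].
  by rewrite mem_filter (unsplitK (inr j)) => /andP[].
rewrite later_columns_rshift => /mapP[i + ->].
by rewrite mem_filter (unsplitK (inl i)) => /andP[].
Qed.

(** Every edge is counted once, at whichever of its ends comes first. *)
Lemma sum_size_later_columns :
  (\sum_x size (later_columns x) = incidence_number P)%N.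
Proof.
rewrite big_split_ord /=.
have szl i : size (later_columns (lshift m i)) =
    (\sum_j (incident P i j &&
      (index (inl i : 'I_n + 'I_m) s < index (inr j : 'I_n + 'I_m) s)%N))%N.
  rewrite later_columns_lshift size_map size_filter -sum1_count big_enum_cond /=.
  by rewrite big_mkcond; apply: eq_bigr => j _; rewrite inE /=; case: ifP.
have szr j : size (later_columns (rshift n j)) =
    (\sum_i (incident P i j &&
      (index (inr j : 'I_n + 'I_m) s < index (inl i : 'I_n + 'I_m) s)%N))%N.
  rewrite later_columns_rshift size_map size_filter -sum1_count big_enum_cond /=.
  by rewrite big_mkcond; apply: eq_bigr => i _; rewrite inE /=; case: ifP.
rewrite (eq_bigr _ (fun i _ => szl i)) (eq_bigr _ (fun j _ => szr j)).
have -> : incidence_number P = (\sum_i \sum_j incident P i j)%N.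
  rewrite /incidence_number -sum1_card big_mkcond /=.
  rewrite (pair_bigA _ (fun i j => incident P i j : nat)) /=.
  by apply: eq_bigr => -[i j] _; rewrite inE /=; case: incident.
rewrite [X in (_ + X)%N]exchange_big -big_split /=.
apply: eq_bigr => i _; rewrite -big_split; apply: eq_bigr => j _ /=.
have : (index (inl i : 'I_n + 'I_m) s != index (inr j : 'I_n + 'I_m) s)%N.
  exact: index_neq.
by case: incident => //; case: ltngtP.
Qed.

End IncidenceOrdering.

Lemma rational_chart_restrict (R : realType) (p q : nat)
    (U W O : set 'M[R]_(p, q)) phi psi : open O ->
  rational_chart U W phi psi ->
  rational_chart (U `&` O) (W `&` psi @^-1` O) phi psi.
Proof.
move=> oO [[oU oW] rphi rpsi UW WU]; split.
- by split; [exact: openI|exact: open_preimage].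
- by move=> i j; apply: rational_on_subset (rphi i j); exact: subIsetl.
- by move=> i j; apply: rational_on_subset (rpsi i j); exact: subIsetl.
- by move=> X [UX OX]; have [WX psiK] := UW X UX; split=> //; split; rewrite //= psiK.
- by move=> Y [WY OY]; have [UY phiK] := WU Y WY.
Qed.

Theorem theorem3p17 (R : realType) (d e n m : nat) (P : labeled_body R e n m)
    (hP : labeled_polytope d P)
    (s : seq ('I_n + 'I_m)%type)
    (hs : degenerate_ordering d (incidence_graph P) s)
    (hi : forall X : 'M[R]_(d, n + m), centered_realization_space P X ->
      forall j : 'I_m,
        free [seq col i (lsubmx X) | i <- enum 'I_n &
                inl i \in later_neighbors (incidence_graph P) s (inr j)])
    (hii : forall X : 'M[R]_(d, n + m), centered_realization_space P X ->
      forall i : 'I_n,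
        free [seq col j (rsubmx X) | j <- enum 'I_m &
                inr j \in later_neighbors (incidence_graph P) s (inl i)]) :
  exists k : nat, k%:Z = natural_guess P d /\
    smooth_submanifold k
      (centered_realization_space P : set 'M[R]_(d, n + m)).
Proof.
exists (d * (n + m) - incidence_number P)%N; split.
  rewrite /natural_guess -subzn// -(sum_size_later_columns hs) mulnC.
  rewrite -[in leqRHS](card_ord (n + m)) -sum_nat_const.
  by apply: leq_sum => x _; exact: size_later_columns_le.
move=> X0 RX0.
have us : uniq [seq unsplit b | b <- s].
  by rewrite map_inj_uniq ?(ordering_uniq hs)//; exact: can_inj (@unsplitK n m).
have sT x : x \in [seq unsplit b | b <- s].
  by rewrite -(splitK x) map_f// (mem_ordering hs).
have fN x : free [seq col y X0 | y <- later_columns P s x].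
  rewrite -(splitK x); case: (fintype.split x) => [i|j] /=.
    rewrite later_columns_lshift -map_comp; have := hii X0 RX0 i.
    congr (free _); apply: eq_map => j /=.
    by apply/colP => k; rewrite !mxE.
  rewrite later_columns_rshift -map_comp; have := hi X0 RX0 j.
  congr (free _); apply: eq_map => i /=.
  by apply/colP => k; rewrite !mxE.
have [U [W [phi [psi [L [chart UX0 dL LP]]]]]] :=
  triangular_system_chart us sT (@index_later_columns R e n m P s) fN.
have nearX0 := near_realization_space hP RX0.
pose O := interior [set X : 'M[R]_(d, n + m) | centered_realization_space P X <->
                            incidence_equations P X].
have oO : open O by exact: open_interior.
have OX0 : O X0 by [].
have OE X : O X -> centered_realization_space P X <-> phi X \in L.
  move=> /interior_subset/= ->; rewrite LP.
  by apply: iff_sym; exact: later_columns_equations.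
have chart' := rational_chart_restrict oO chart.
exists (U `&` O), (W `&` psi @^-1` O), phi, psi, L.
have [[oU oW] rphi rpsi UW WU] := chart'; split=> //.
- exact: rational_chart_diffeomorphism.
- by rewrite -dL (sum_size_later_columns hs) addnK.
- apply/seteqP; split=> [_ [X [RX [UX OX]] <-]|Y [WY LY]].
    by have [? _] := UW X (conj UX OX); split=> //; apply/OE.
  have [[UpsiY OpsiY] phiK] := WU Y WY.
  by exists (psi Y) => //; split=> //; apply/OE; rewrite ?phiK.
Qed.
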